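(* Let $j\in\mathbb{N}$ be fixed. Then $$\mu_{n-j+1,n}= 4-\frac{16\pi^{2}j^{2}}{\log^{2}n}+\frac{32\pi^{2}j^{2}\left(\gamma+6\log 2\right)}{\log^{3}n}+O\left(\frac{1}{\log^{4}n}\right), \quad n\to\infty,$$ where $\gamma$ is the Euler--Mascheroni constant. In particular, $$\|L_{n}\|= 4-\frac{16\pi^{2}}{\log^{2}n}+\frac{32\pi^{2}\left(\gamma+6\log 2\right)}{\log^{3}n}+O\left(\frac{1}{\log^{4}n}\right), \quad n\to\infty.$$
   Context: For $n\in\mathbb{N}=\{1,2,\dots\}$, $L_{n}$ denotes the $n\times n$ real symmetric matrix with entries $(L_{n})_{i,j}=\dfrac{1}{\max(i,j)+1}$ for $i,j=0,1,\dots,n-1$. Its eigenvalues (counted with multiplicity, in nondecreasing order) are denoted $\mu_{1,n}\leq\mu_{2,n}\leq\dots\leq\mu_{n,n}$. $\|L_n\|$ is the operator (spectral) norm of $L_n$ on $\mathbb{C}^n$ with the Euclidean norm. $\log^k n$ means $(\log n)^k$. *)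

(* Defs.v *)
From HB Require Import structures.
From mathcomp Require Import all_boot all_order all_algebra.
From mathcomp Require Import complex polyrcf.
From mathcomp Require Import all_classical all_reals all_analysis.

Set Implicit Arguments.
Unset Strict Implicit.
Unset Printing Implicit Defensive.

Import Order.TTheory GRing.Theory Num.Theory.
Import numFieldNormedType.Exports.

Local Open Scope classical_set_scope.
Local Open Scope ring_scope.

Definition Lmx (R : realType) (n : nat) : 'M[R]_n :=
  \matrix_(i < n, j < n) ((maxn i j).+1%:R)^-1.

(* rootsR lists the distinct real roots increasingly, so these are the real
   eigenvalues of A in nondecreasing order, each repeated according
   to its algebraic multiplicity. *)
Definition eigenvalues (R : realType) (n : nat) (A : 'M[R]_n) : seq R :=
  flatten [seq nseq (mup x (char_poly A)) x | x <- rootsR (char_poly A)].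

(* k is 1-based; only the values for 1 <= k <= n are meaningful. *)
Definition mu (R : realType) (k n : nat) : R :=
  nth 0 (eigenvalues (Lmx R n)) k.-1.

Definition enorm (R : realType) (n : nat) (v : 'cV[R[i]]_n) : R :=
  Num.sqrt (\sum_(i < n) ComplexField.Normc.normc (v i 0) ^+ 2).

Definition opnorm (R : realType) (n : nat) (A : 'M[R[i]]_n) : R :=
  sup [set enorm (A *m v) | v in [set v : 'cV[R[i]]_n | enorm v <= 1]].

Definition norm_Lmx (R : realType) (n : nat) : R :=
  opnorm (map_mx (real_complex R) (Lmx R n)).

Definition euler_gamma (R : realType) : R :=
  limn (fun n : nat => \sum_(1 <= k < n.+1) k%:R^-1 - ln (n%:R : R)).

Lemma eigenvalues_sorted (R : realType) (n : nat) (A : 'M[R]_n) :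
  sorted <=%R (eigenvalues A).
Proof.
rewrite /eigenvalues.
have : sorted <%R (rootsR (char_poly A)) by exact: sorted_roots.
move: (rootsR _) => s; rewrite -[sorted <%R s]/(sorted _ s).
elim: s => [//|x s IH] /= xs.
rewrite (sorted_pairwise le_trans) pairwise_cat.
rewrite -!(sorted_pairwise le_trans) IH ?(path_sorted xs) // andbT.
apply/andP; split.
  apply/allrelP => a b /nseqP[-> _] /flatten_mapP[y ys /nseqP[-> _]].
  move: xs; rewrite (path_sortedE lt_trans) => /andP[/allP h _].
  exact/ltW/h.
by elim: (mup _ _) => [//|[|k] //= ->]; rewrite lexx.
Qed.

Lemma char_poly_conj (F : fieldType) (n : nat) (P D : 'M[F]_n) :
  P \in unitmx -> char_poly (invmx P *m D *m P) = char_poly D.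
Proof.
move=> Pu; pose Q := map_mx polyC P; pose Q' := map_mx polyC (invmx P).
have QQ : Q' *m Q = 1%:M by rewrite -map_mxM mulVmx // map_mx1.
have E : char_poly_mx (invmx P *m D *m P) = Q' *m char_poly_mx D *m Q.
  rewrite /char_poly_mx mulmxBr mulmxBl !map_mxM -/Q -/Q'; congr (_ - _).
  by rewrite scalar_mxC -mulmxA QQ mulmx1.
rewrite /char_poly E !det_mulmx mulrAC -det_mulmx QQ det1 mul1r //.
Qed.

Lemma symmetric_split (R : realType) (n : nat) (A : 'M[R]_n) : A^T = A ->
  exists s : seq R, char_poly A = \prod_(x <- s) ('X - x%:P).
Proof.
move=> As; pose AC := map_mx (real_complex R) A.
have hA : AC \is hermsymmx.
  apply/is_hermitianmxP; rewrite expr0 scale1r.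
  apply/matrixP => i j; rewrite !mxE -[in LHS]As mxE.
  by apply/esym/CrealP; rewrite complex_real.
have /hermitian_normalmx/orthomx_spectralP eA := hA.
have dr := hermitian_spectral_diag_real hA.
set P := spectralmx AC in eA; set d := spectral_diag AC in eA dr.
have Pu : P \in unitmx by exact: spectral_unit.
exists [seq complex.Re (d 0 i) | i <- enum 'I_n].
apply: (map_poly_inj (real_complex R)).
rewrite -/AC map_char_poly -/AC.
have -> : char_poly AC = char_poly (diag_mx d).
  by rewrite eA char_poly_conj.
rewrite char_poly_trig ?diag_mx_is_trig // rmorph_prod big_map big_enum.
apply: eq_bigr => i _; rewrite rmorphB /= map_polyX map_polyC /=.
rewrite mxE eqxx mulr1n; congr (_ - _%:P).
by have /mxOverP/(_ 0 i)/RRe_real := dr.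
Qed.

Lemma eigenvalues_prod (R : realType) (n : nat) (A : 'M[R]_n) : A^T = A ->
  char_poly A = \prod_(x <- eigenvalues A) ('X - x%:P).
Proof.
move=> /symmetric_split[s es]; rewrite es; apply: perm_big.
have p0 : char_poly A != 0 by rewrite monic_neq0 // char_poly_monic.
apply/permP => a.
suff: perm_eq s (eigenvalues A) by move/permP.
apply/allP => x _ /=; rewrite /eigenvalues.
have -> : count_mem x s = mup x (char_poly A) by rewrite es mu_prod_XsubC.
pose m y := mup y (char_poly A).
rewrite -/(m x).
rewrite count_flatten -map_comp sumnE big_map.
have u : uniq (rootsR (char_poly A)) by exact: uniq_roots.
have memr y : (y \in rootsR (char_poly A)) = root (char_poly A) y.
  by rewrite -roots_on_rootsR // in_itv.
have E y : (count_mem x \o (fun y => nseq (m y) y)) y =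
           if y == x then m x else 0%N.
  by rewrite /= count_nseq /=; case: eqVneq => [->|_]; rewrite ?mul1n ?mul0n.
rewrite (eq_bigr _ (fun y _ => E y)).
case: (boolP (x \in rootsR (char_poly A))) => xr.
  rewrite (bigD1_seq x) //= eqxx big1 ?addn0 // => y.
  by case: eqVneq.
rewrite big_seq big1 ?/m ?mupNroot -?memr // => y ys.
by case: eqVneq ys xr => // -> ->.
Qed.

Lemma size_eigenvalues (R : realType) (n : nat) (A : 'M[R]_n) : A^T = A ->
  size (eigenvalues A) = n.
Proof.
move=> /eigenvalues_prod /(congr1 (fun p : {poly R} => (size p).-1)).
by rewrite size_char_poly size_prod_XsubC.
Qed.

Lemma tr_Lmx (R : realType) (n : nat) : (Lmx R n)^T = Lmx R n.
Proof. by apply/matrixP => i j; rewrite !mxE maxnC. Qed.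

(* Main.v *)
Require Import Defs.
From mathcomp Require Import all_boot all_order all_algebra.
From mathcomp Require Import complex polyrcf ring lra zify.
From mathcomp Require Import all_classical all_reals all_analysis.

Set Implicit Arguments.
Unset Strict Implicit.
Unset Printing Implicit Defensive.

Import Order.TTheory GRing.Theory Num.Theory.
Import numFieldNormedType.Exports.
Local Open Scope classical_set_scope.
Local Open Scope ring_scope.

(** Let W_n(y) = det (1 - y L_n), so that the nonzero eigenvalues of L_n are the
  inverses of the zeros of W_n. Multiplying 1 - y L_n by a bidiagonal matrix and
  its transpose turns it into a Jacobi matrix minus y, whence the recurrence
    (n+1)^2 W_(n+1) = ((n+1)^2 + n^2 - y) W_n - n^2 W_(n-1),  W_0 = 1
  ([det_Lmx]); the W_n are continuous dual Hahn polynomials. Near the top of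
  the spectrum put y = 1/4 + t^2, so that the eigenvalue is 4/(1 + 4 t^2).

  At t = 0 the solution is a positive sum, W_n(1/4) = sum_k b_(n-k) b_k^2 with
  b_k = binom(2k,k)/4^k ([crit_rec]). Let kappa be the limit of n b_n^2 (its
  value 1/pi is never needed) and ell_n = W_n(1/4) / (kappa b_n). Two exact
  convolution identities ([conv_cb_inv], [conv_cb2_inv]), in which b_k^2 is
  replaced by kappa/k up to an error O(1/k^2), give
    ell_n = 6 H_(2n) - 5 H_n + O(H_n / n) = ln n + gamma + 6 ln 2 + o(1)
  ([ell_harm], [ell_ln]): this is where the constant of the theorem comes from.

  For t > 0 the quotient g_n = W_n / b_n satisfies a recurrence in self-adjoint
  form ([gsol_rec]), a discretization of (n d/dn)^2 g + t^2 g = 0. The sequence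
  sin (t ell_n) / t satisfies it up to a residual which is t^2 times a summable
  sequence ([res_bound]): the main error terms cancel because ell_n is itself a
  solution at t = 0 and because its flux, the weighted difference
  q_n (ell_(n+1) - ell_n) with q_n = (n+1)^2 b_n b_(n+1), tends to kappa
  ([fl_ge], [fl_upper]).
  A discrete Gronwall argument ([err_bound]) then gives, uniformly for
  x = t ell_n in a bounded interval,
    t g_n / kappa = sin x + O(x^3 / ell_n^2)
  together with the analogous approximation of the flux of g by cos x ([W_sin],
  [flux_cos]).

  The zeros of W_n with x <= pi j + 1 thus lie in windows of radius 1 around pi,
  2 pi, ..., pi j. Each window contains a zero by a change of sign, and only
  one, with multiplicity, because the Christoffel-Darboux formula [CD_deriv]
  makes the quotient of W_n by the nonvanishing flux strictly monotone
  ([at_most_one_zero]). There is no zero y <= 1/4 ([W_gt0]). Counting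
  eigenvalues, the j-th largest one is 1/(1/4 + t^2) with
  t ell_n = pi j + O(1 / ell_n^2) ([mu_loc]), and a Taylor expansion
  ([expansion]) yields the theorem. Finally all the eigenvalues are
  nonnegative, so that the norm of L_n is the largest of them ([norm_LmxE]). *)

(** * Central binomial numbers *)

Section CentralBinomial.
Context (R : realType).
Implicit Types n k : nat.

(** The central binomial numbers binom(2n,n) / 4^n, given by their quotients. *)
Fixpoint cb n : R :=
  if n is m.+1 then cb m * ((m%:R + 1 / 2) / (m%:R + 1)) else 1.

(** The harmonic numbers 1 + 1/2 + ... + 1/n. *)
Definition harm n : R := \sum_(k < n) (k%:R + 1)^-1.

(** The sums of 1/(k + 1/2) for k < n. *)
Definition odd_harm n : R := \sum_(k < n) (k%:R + 1 / 2)^-1.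

Lemma natr1_neq0 n : n%:R + 1 != 0 :> R.
Proof. by have := ler0n R n; lra. Qed.

Lemma cbS n : (n%:R + 1) * cb n.+1 = (n%:R + 1 / 2) * cb n.
Proof. by rewrite /=; field; rewrite natr1_neq0. Qed.

Lemma cb_gt0 n : 0 < cb n.
Proof.
elim: n => [|n IH] /=; first exact: ltr01.
by rewrite mulr_gt0 // divr_gt0 //; have := ler0n R n; lra.
Qed.

Lemma odd_harmE n : odd_harm n = 2 * harm n.*2 - harm n.
Proof.
elim: n => [|n IH]; first by rewrite /odd_harm /harm !big_ord0 mulr0 subr0.
rewrite /odd_harm big_ord_recr /= -/(odd_harm n) IH.
rewrite /harm doubleS !big_ord_recr /= -!/(harm _) -addn1 !natrD -muln2 !natrM.
by field; have := ler0n R n; move=> h; repeat (apply/andP; split) => //; lra.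
Qed.

(** Both sides satisfy the same first-order recurrence in n; so do those of the
  next identity. *)
Lemma conv_cb_inv n :
  \sum_(k < n) cb k / (n - k)%:R = cb n * odd_harm n.
Proof.
pose U m : R := \sum_(k < m) cb k / (m - k)%:R.
have US m : (m%:R + 1) * U m.+1 = (m%:R + 1 / 2) * U m + cb m.
  have e1 : (m%:R + 1) * U m.+1 =
      \sum_(k < m.+1) cb k + \sum_(k < m) (k%:R + 1) * cb k.+1 / (m - k)%:R.
    rewrite mulr_sumr.
    have -> : \sum_(k < m) (k%:R + 1) * cb k.+1 / (m - k)%:R =
        \sum_(k < m.+1) k%:R * cb k / (m.+1 - k)%:R.
      rewrite [RHS]big_ord_recl mul0r mul0r add0r; apply: eq_bigr => k _.
      by rewrite lift0 subSS -natr1.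
    rewrite -big_split /=; apply: eq_bigr => k _.
    have km : (k <= m)%N by rewrite -ltnS.
    rewrite natrB; last by lia.
    rewrite -natr1; field.
    by move: km; rewrite -(ler_nat R); lra.
  have e2 : (m%:R + 1 / 2) * U m =
      \sum_(k < m) cb k + \sum_(k < m) (k%:R + 1) * cb k.+1 / (m - k)%:R.
    rewrite mulr_sumr -big_split /=; apply: eq_bigr => k _.
    rewrite -/(cb k.+1) cbS natrB; last exact: ltnW.
    field; have : (k.+1 <= m)%N by [].
    by rewrite -(ler_nat R) -natr1; lra.
  rewrite e1 e2 big_ord_recr /=; ring.
rewrite -/(U n); elim: n => [|n IH].
  by rewrite /U /odd_harm !big_ord0 mulr0.
apply: (mulfI (natr1_neq0 n)); rewrite US IH [RHS]mulrA cbS.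
rewrite /odd_harm big_ord_recr /= -/(odd_harm n).
by field; have := ler0n R n; lra.
Qed.

Lemma conv_cb2_inv n :
  \sum_(k < n) cb k ^+ 2 / (n - k)%:R = 2 * cb n ^+ 2 * odd_harm n.
Proof.
pose U m : R := \sum_(k < m) cb k ^+ 2 / (m - k)%:R.
have US m : (m%:R + 1) ^+ 2 * U m.+1 =
    (m%:R + 1 / 2) ^+ 2 * U m + (2 * m%:R + 1) * cb m ^+ 2.
  have e1 : (m%:R + 1) ^+ 2 * U m.+1 =
      \sum_(k < m.+1) (m%:R + k%:R + 1) * cb k ^+ 2 +
      \sum_(k < m) (k%:R + 1) ^+ 2 * cb k.+1 ^+ 2 / (m - k)%:R.
    rewrite mulr_sumr.
    have -> : \sum_(k < m) (k%:R + 1) ^+ 2 * cb k.+1 ^+ 2 / (m - k)%:R =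
        \sum_(k < m.+1) k%:R ^+ 2 * cb k ^+ 2 / (m.+1 - k)%:R.
      rewrite [RHS]big_ord_recl [X in _ = X + _](_ : _ = 0) ?add0r; last first.
        by rewrite expr0n /= !mul0r.
      by apply: eq_bigr => k _; rewrite lift0 subSS -natr1.
    rewrite -big_split /=; apply: eq_bigr => k _.
    have km : (k <= m)%N by rewrite -ltnS.
    rewrite natrB; last by lia.
    rewrite -natr1; field.
    by move: km; rewrite -(ler_nat R); lra.
  have e2 : (m%:R + 1 / 2) ^+ 2 * U m =
      \sum_(k < m) (m%:R + k%:R + 1) * cb k ^+ 2 +
      \sum_(k < m) (k%:R + 1) ^+ 2 * cb k.+1 ^+ 2 / (m - k)%:R.
    rewrite mulr_sumr -big_split /=; apply: eq_bigr => k _.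
    rewrite -/(cb k.+1) -exprMn cbS natrB; last exact: ltnW.
    field; have : (k.+1 <= m)%N by [].
    by rewrite -(ler_nat R) -natr1; lra.
  rewrite e1 e2 big_ord_recr /=; ring.
rewrite -/(U n); elim: n => [|n IH].
  by rewrite /U /odd_harm !big_ord0 mulr0.
apply: (mulfI (expf_neq0 2 (natr1_neq0 n))); rewrite US IH.
have -> : (n%:R + 1) ^+ 2 * (2 * cb n.+1 ^+ 2 * odd_harm n.+1) =
    2 * ((n%:R + 1) * cb n.+1) ^+ 2 * odd_harm n.+1 by ring.
rewrite cbS.
rewrite /odd_harm big_ord_recr /= -/(odd_harm n).
by field; have := ler0n R n; lra.
Qed.

(** The convolution of b_k and b_k^2. It is the value at 1/4 of the polynomials W_n
  defined below, hence the solution at t = 0; see [W_crit]. *)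
Definition crit n : R := \sum_(k < n.+1) cb (n - k) * cb k ^+ 2.

Lemma crit_gt0 n : 0 < crit n.
Proof.
rewrite /crit big_ord_recr /= subnn mul1r ltr_wpDl ?exprn_gt0 ?cb_gt0 //.
by apply: sumr_ge0 => k _; rewrite mulr_ge0 ?exprn_ge0 // ltW // cb_gt0.
Qed.

Lemma crit_rec n :
  (n%:R + 2) ^+ 2 * crit n.+2 =
  (2 * (n%:R + 1) ^+ 2 + 2 * (n%:R + 1) + 3 / 4) * crit n.+1
  - (n%:R + 1) ^+ 2 * crit n.
Proof.
pose x : R := n%:R.
pose T m k : R := cb (m - k) * cb k ^+ 2.
(* The certificate that makes the summands of the recurrence telescope. *)
pose G k : R := k%:R ^+ 2 * T n.+1 k / (2 * (n.+2 - k)%:R).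
have tele k : (k <= n)%N ->
    (x + 2) ^+ 2 * T n.+2 k
    - (2 * (x + 1) ^+ 2 + 2 * (x + 1) + 3 / 4) * T n.+1 k
    + (x + 1) ^+ 2 * T n k = G k.+1 - G k.
  move=> kn; rewrite /G /T !subSS.
  have -> : (n.+2 - k = (n - k).+2)%N by lia.
  have -> : (n.+1 - k = (n - k).+1)%N by lia.
  have -> : x = (n - k)%:R + k%:R by rewrite /x natrB //; ring.
  rewrite /=; move: (n - k)%N => j.
  rewrite -![_.+1%:R]natr1 /=; field.
  by have := ler0n R j; have := ler0n R k;
     move=> h1 h2; repeat (apply/andP; split); lra.
have := telescope_sumr G (leq0n n.+1).
rewrite big_mkord => S.
have : \sum_(k < n.+1) ((x + 2) ^+ 2 * T n.+2 k
    - (2 * (x + 1) ^+ 2 + 2 * (x + 1) + 3 / 4) * T n.+1 k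
    + (x + 1) ^+ 2 * T n k) = G n.+1 - G 0%N.
  by rewrite -S; apply: eq_bigr => k _; apply: tele; rewrite -ltnS.
rewrite !big_split /= sumrN -!mulr_sumr => e.
have c1 : crit n.+1 = \sum_(k < n.+1) T n.+1 k + T n.+1 n.+1.
  by rewrite /crit big_ord_recr.
have c2 : crit n.+2 = \sum_(k < n.+1) T n.+2 k + T n.+2 n.+1 + T n.+2 n.+2.
  by rewrite /crit 2!big_ord_recr.
have c0 : crit n = \sum_(k < n.+1) T n k by [].
rewrite {}c2 {}c1 {}c0; move: e.
rewrite /G [T n.+1 n.+1]/T [T n.+2 n.+1]/T [T n.+2 n.+2]/T subSnn !subnn.
rewrite /= -[n.+1%:R]natr1 expr0n /= !mul0r subr0 -/x mulr1 !mul1r.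
set S0 := \sum_(i < _) T n i; set S1 := \sum_(i < _) T n.+1 i.
set S2 := \sum_(i < _) T n.+2 i => e.
have h := ler0n R n; rewrite -/x in h.
have n1 : x + 1 + 1 != 0 by lra.
have n2 : x + 1 != 0 by lra.
have -> : S2 = (cb n * ((x + 1 / 2) / (x + 1))) ^+ 2 * (x + 1) ^+ 2 / (2 * (x + 2) ^+ 2)
   + (2 * (x + 1) ^+ 2 + 2 * (x + 1) + 3 / 4) / (x + 2) ^+ 2 * S1
   - (x + 1) ^+ 2 / (x + 2) ^+ 2 * S0.
  have n3 : (x + 2) ^+ 2 != 0 by rewrite expf_neq0 //; lra.
  apply: (mulfI n3).
  have e' : (x + 2) ^+ 2 * S2 =
      (x + 1) ^+ 2 * (cb n * ((x + 1 / 2) / (x + 1))) ^+ 2 / 2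
      + (2 * (x + 1) ^+ 2 + 2 * (x + 1) + 3 / 4) * S1 - (x + 1) ^+ 2 * S0.
      by move: e; lra.
  rewrite e'; field; rewrite n2; apply/andP; split; lra.
by field; rewrite n2 n1 /=; lra.
Qed.

End CentralBinomial.

Arguments cb : simpl never.

Lemma cb0 (R : realType) : cb R 0 = 1. Proof. by []. Qed.

Lemma cb1 (R : realType) : cb R 1 = 1 / 2.
Proof. by rewrite /cb; field. Qed.

(** * Tridiagonal determinants *)

Section TridiagonalDet.

Lemma det_tridiag (R : comRingType) (f : nat -> nat -> R) (n : nat) :
  (forall i j, (i.+1 < j)%N -> f i j = 0) ->
  (forall i j, (j.+1 < i)%N -> f i j = 0) ->
  \det (\matrix_(i < n.+2, j < n.+2) f i j) =
    f n.+1 n.+1 * \det (\matrix_(i < n.+1, j < n.+1) f i j)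
    - f n.+1 n * f n n.+1 * \det (\matrix_(i < n, j < n) f i j).
Proof.
move=> fu fl; set A := \matrix_(i, j) f i j.
rewrite (expand_det_row A ord_max) big_ord_recr big_ord_recr /= big1; last first.
  move=> j _; rewrite mxE fl ?mul0r //=.
  by rewrite !ltnS ltn_ord.
have b1 (k : 'I_n.+1) : bump n.+1 k = k by rewrite /bump leqNgt ltn_ord.
have b2 (k : 'I_n) : bump n k = k by rewrite /bump leqNgt ltn_ord.
have b3 (k : 'I_n) : bump n.+1 k = k by rewrite /bump leqNgt ltnS ltnW.
rewrite add0r addrC !mxE /=; congr (_ + _).
  rewrite /cofactor -signr_odd addnn odd_double expr0 mul1r.
  by congr (_ * \det _); apply/matrixP => i j; rewrite !mxE /= !b1.
rewrite -mulrA -mulrN; congr (_ * _).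
rewrite /cofactor /= addSn -signr_odd /= addnn odd_double expr1 mulN1r.
congr (- _); set M := row' _ _.
have bn : bump n n = n.+1 by rewrite /bump leqnn.
rewrite (expand_det_col M ord_max) big_ord_recr /= big1; last first.
  by move=> i _; rewrite !mxE /= b3 bn fu ?mul0r // ltnS.
rewrite add0r !mxE /= bn; have -> : bump n.+1 n = n by rewrite /bump ltnn.
congr (_ * _); rewrite /cofactor -signr_odd addnn odd_double expr0 mul1r.
by congr (\det _); apply/matrixP => i j; rewrite !mxE /= !b2 b3.
Qed.

End TridiagonalDet.

(** * The polynomials det (1 - x L_n) *)

Section CharacteristicPolynomials.
Context (R : realType).
Implicit Types n m k : nat.

(** The pair (W_n, W_(n-1)); for n = 0 the second entry is a dummy, as its
  coefficient n^2 vanishes. *)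
Fixpoint Wpair n : {poly R} * {poly R} :=
  if n is m.+1 then
    (((m%:R + 1) ^- 2) *:
       (((m%:R + 1) ^+ 2 + m%:R ^+ 2)%:P * (Wpair m).1 - 'X * (Wpair m).1
        - m%:R ^+ 2 *: (Wpair m).2),
     (Wpair m).1)
  else (1, 0).

(** The polynomials defined by the three-term recurrence [W_rec]; by [det_Lmx]
  they are the determinants of 1 - x L_n. *)
Definition W n := (Wpair n).1.

Lemma W0 : W 0 = 1. Proof. by []. Qed.

Lemma WE n : W n.+1 = ((n%:R + 1) ^- 2) *:
   (((n%:R + 1) ^+ 2 + n%:R ^+ 2)%:P * W n - 'X * W n - n%:R ^+ 2 *: W n.-1).
Proof. by case: n => [|n] //=; rewrite /W /= expr0n !scale0r. Qed.

Lemma W_rec n x : (n%:R + 1) ^+ 2 * (W n.+1).[x] =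
  ((n%:R + 1) ^+ 2 + n%:R ^+ 2 - x) * (W n).[x] - n%:R ^+ 2 * (W n.-1).[x].
Proof.
rewrite WE !(hornerZ, hornerD, hornerN, hornerM, hornerC, hornerX).
by field; exact: natr1_neq0.
Qed.

Lemma dW_rec n x : (n%:R + 1) ^+ 2 * (W n.+1)^`().[x] =
  ((n%:R + 1) ^+ 2 + n%:R ^+ 2 - x) * (W n)^`().[x] - (W n).[x]
  - n%:R ^+ 2 * (W n.-1)^`().[x].
Proof.
rewrite WE derivZ !derivB derivZ !derivM derivX derivC.
rewrite !(hornerZ, hornerD, hornerN, hornerM, hornerC, hornerX).
by field; exact: natr1_neq0.
Qed.

Lemma W1 x : (W 1).[x] = 1 - x.
Proof. by have := W_rec 0 x; rewrite W0 hornerC; lra. Qed.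

Lemma W_crit n : (W n).[1 / 4] = crit R n.
Proof.
suff: (W n).[1 / 4] = crit R n /\ (W n.+1).[1 / 4] = crit R n.+1 by case.
elim: n => [|n [IH1 IH2]].
  rewrite W0 W1 /crit !big_ord_recr !big_ord0 /= !hornerE /=.
  by rewrite ?subnn ?subn0 !cb0 cb1; split; field.
split=> //; apply: (mulfI (expf_neq0 2 (natr1_neq0 R n.+1))).
rewrite W_rec IH1 IH2 -natr1 /=.
have := crit_rec R n; set c := crit R n.+2.
by rewrite -!addrA => ->; field.
Qed.

(** The two Christoffel-Darboux identities, at one and at two points. *)
Lemma CD_deriv n x : (n%:R + 1) ^+ 2 *
    ((W n.+1)^`().[x] * (W n).[x] - (W n.+1).[x] * (W n)^`().[x]) =
  - \sum_(m < n.+1) (W m).[x] ^+ 2.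
Proof.
elim: n => [|n IH].
  have := dW_rec 0 x; have := W_rec 0 x.
  rewrite /= W0 -polyC1 derivC !hornerC big_ord_recr big_ord0 /= W0 -polyC1 hornerC => h1 h2.
  by lra.
rewrite big_ord_recr /= opprD -IH.
have e1 := W_rec n.+1 x; have e2 := dW_rec n.+1 x.
rewrite mulrBr !mulrA e1 e2 -[n.+1%:R]natr1 /=; ring.
Qed.

Lemma CD_diff n x y : (n%:R + 1) ^+ 2 *
    ((W n.+1).[x] * (W n).[y] - (W n.+1).[y] * (W n).[x]) =
  (y - x) * \sum_(m < n.+1) (W m).[x] * (W m).[y].
Proof.
elim: n => [|n IH].
  have := W_rec 0 x; have := W_rec 0 y.
  rewrite /= W0 -polyC1 !hornerC big_ord_recr big_ord0 /= W0 -polyC1 !hornerC => h1 h2.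
  by lra.
rewrite big_ord_recr /= [RHS]mulrDr -IH.
have e1 := W_rec n.+1 x; have e2 := W_rec n.+1 y.
rewrite mulrBr !mulrA e1 e2 -[n.+1%:R]natr1 /=; ring.
Qed.

(** By [CD_diff] at x and 1/4, the quotient W_n(x) / W_n(1/4) increases with n
  when x <= 1/4. *)
Lemma W_gt0 n x : x <= 1 / 4 -> 0 < (W n).[x].
Proof.
move=> x4; elim/ltn_ind: n => -[_|n IH]; first by rewrite W0 hornerE.
have := CD_diff n x (1 / 4).
rewrite !W_crit => e.
have c0 := crit_gt0 R n; have c1 := crit_gt0 R n.+1.
have wn := IH n (ltnSn n).
have s0 : 0 <= (1 / 4 - x) * \sum_(m < n.+1) (W m).[x] * (W m).[1 / 4].
  rewrite mulr_ge0 ?subr_ge0 //; apply: sumr_ge0 => m _.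
  by rewrite W_crit mulr_ge0 ?ltW ?crit_gt0 // IH.
rewrite -e in s0.
have n1 : 0 < (n%:R + 1 : R) ^+ 2 by rewrite exprn_gt0 //; have := ler0n R n; lra.
move: s0; rewrite pmulr_rge0 // subr_ge0 => s0.
rewrite -(pmulr_lgt0 _ c0); apply: lt_le_trans s0.
exact: mulr_gt0.
Qed.

(** With U_(i,j) = 1/(j+1) for i <= j one has L = U^T U, and U is invertible with a
  bidiagonal inverse V. Hence V^T (1 - x L) V = V^T V - x is tridiagonal. *)
Lemma det_Lmx n x : \det (1%:M - x *: Lmx R n) = (W n).[x].
Proof.
pose U : 'M[R]_n := \matrix_(i, j) ((i <= j)%N%:R / (j%:R + 1)).
pose v i j : R := (i%:R + 1) * ((i == j)%:R - (i.+1 == j)%:R).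
pose V : 'M[R]_n := \matrix_(i, j) v i j.
have sumE (a : nat) (F : nat -> R) :
    \sum_(j < n) (a == j)%:R * F j = (a < n)%:R * F a.
  case: (ltnP a n) => an.
    rewrite (bigD1 (Ordinal an)) //= eqxx big1 ?addr0 // => j.
    by rewrite -val_eqE /= eq_sym => /negbTE->; rewrite mul0r.
  rewrite mul0r big1 // => j _; case: eqP => [e|]; last by rewrite mul0r.
  by have := ltn_ord j; rewrite -e ltnNge an.
have VU : V *m U = 1%:M.
  apply/matrixP => i k; rewrite !mxE.
  under eq_bigr => j _ do rewrite !mxE /v -mulrA mulrBl.
  rewrite -mulr_sumr sumrB.
  rewrite (sumE i (fun j => (j <= k)%:R / (k%:R + 1))).
  rewrite (sumE i.+1 (fun j => (j <= k)%:R / (k%:R + 1))) ltn_ord mul1r.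
  have hk := ltn_ord k; have k1 := natr1_neq0 R k.
  case: (ltngtP i k) => ik.
  - by rewrite (leq_ltn_trans ik) // !mul1r subrr mulr0 (_ : _ == _ = false) // -val_eqE /= ltn_eqF.
  - by rewrite !mul0r mulr0 subrr mulr0 (_ : _ == _ = false) // -val_eqE /= gtn_eqF.
  - by rewrite !mul0r mulr0 subr0 mul1r (_ : _ == _) ?ik ?divff // -val_eqE /= ik.
have LU : Lmx R n = U^T *m U.
  apply/matrixP => i j; rewrite !mxE.
  under eq_bigr => m _ do rewrite !mxE mulrACA -natrM mulnb -leq_min.
  rewrite -mulr_suml -natr_sum.
  have -> : (\sum_(m < n) (m <= minn i j) = (minn i j).+1)%N.
    have hn : ((minn i j).+1 <= n)%N by rewrite (leq_ltn_trans (geq_minl i j)).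
    transitivity (\sum_(m < (minn i j).+1) 1)%N; last first.
      by rewrite sum_nat_const card_ord muln1.
    rewrite (big_ord_widen n (fun=> 1%N) hn) [RHS]big_mkcond /=.
    by apply: eq_bigr => m _; rewrite ltnS; case: (m <= _)%N.
  have hi := natr1_neq0 R i; have hj := natr1_neq0 R j.
  by case: (leqP i j) => ij; rewrite -natr1 -[(_.+1)%:R]natr1; field; rewrite hi hj.
have VV : V^T *m (1%:M - x *: Lmx R n) *m V = V^T *m V - x%:M.
  rewrite mulmxBr mulmx1 mulmxBl LU -scalemxAr -scalemxAl !mulmxA.
  rewrite -trmx_mul.
  have UV : U *m V = 1%:M by exact: mulmx1C.
  by rewrite UV trmx1 mul1mx UV scalemx1.
pose f i j : R := (if i == j then (i%:R + 1) ^+ 2 + i%:R ^+ 2 - x else 0)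
  - (if i.+1 == j then (i%:R + 1) ^+ 2 else 0)
  - (if j.+1 == i then (j%:R + 1) ^+ 2 else 0).
have VVf : V^T *m V - x%:M = \matrix_(i < n, j < n) f i j.
  apply/matrixP => i j; rewrite !mxE.
  pose G (m : nat) : R := (m%:R + 1) ^+ 2 * ((m == j)%:R - (m.+1 == j)%:R).
  rewrite (eq_bigr (fun m : 'I_n => (nat_of_ord i == m)%:R * G m
      - (0 < i)%:R * ((i.-1 == m)%:R * G m))); last first.
    move=> m _; rewrite !mxE /v /G [(m : nat) == i]eq_sym.
    have -> : (m.+1 == i)%:R = (0 < i)%:R * (i.-1 == m)%:R :> R.
      by case: (nat_of_ord i) => [|i'] /=; rewrite ?mul0r ?mul1r // eqSS eq_sym.
    ring.
  rewrite sumrB -mulr_sumr !sumE ltn_ord (leq_ltn_trans (leq_pred i) (ltn_ord i)).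
  rewrite !mul1r /G /f -val_eqE /=; move: (nat_of_ord i) (nat_of_ord j) => a c.
  case: a => [|a] /=; case: c => [|c] /=; rewrite ?eqSS -?natr1 ?mulr0n ?mulr1n ?mul0r.
  - ring.
  - by case: (0%N == c); rewrite /= ?mulr0n ?mulr1n; ring.
  - by case: a => [|a] /=; rewrite ?mulr0n ?mulr1n; ring.
  - rewrite [(c.+1 == a)]eq_sym; have [<-|ac] := eqVneq a c.
      rewrite [a.+1 == a]gtn_eqF // [a == a.+1]ltn_eqF // !mulr0n !mulr1n; ring.
    have [->|ac1] := eqVneq a c.+1.
      by rewrite [c.+2 == c]gtn_eqF // !mulr0n !mulr1n -!natr1; ring.
    by case: (a.+1 == c); rewrite /= !mulr0n ?mulr1n; ring.
have detf m : \det (\matrix_(i < m, j < m) f i j) =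
    (\prod_(i < m) (i%:R + 1)) ^+ 2 * (W m).[x].
  pose D m := \det (\matrix_(i < m, j < m) f i j).
  pose E m := (\prod_(i < m) (i%:R + 1 : R)) ^+ 2 * (W m).[x].
  suff: D m = E m /\ D m.+1 = E m.+1 by case.
  elim: m => [|m [IH1 IH2]].
    rewrite /D /E det_mx00 det_mx11 !mxE /f /= W0 W1 big_ord0 big_ord_recr.
    by rewrite big_ord0 -polyC1 hornerC /=; split; ring.
  split=> //; rewrite {1}/D det_tridiag; last 2 first.
  - move=> i j ij; rewrite /f (ltn_eqF (ltnW ij)) (ltn_eqF ij) gtn_eqF ?subrr //.
    by lia.
  - move=> i j ij; rewrite /f (gtn_eqF (ltnW ij)) (ltn_eqF ij) gtn_eqF ?subrr //.
    by lia.
  have f1 : f m.+1 m.+1 = (m.+1%:R + 1) ^+ 2 + m.+1%:R ^+ 2 - x.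
    by rewrite /f eqxx gtn_eqF // !subr0.
  have f2 : f m.+1 m = - (m%:R + 1) ^+ 2.
    by rewrite /f eqxx !gtn_eqF // subr0 sub0r.
  have f3 : f m m.+1 = - (m%:R + 1) ^+ 2.
    by rewrite /f eqxx ltn_eqF // gtn_eqF // subr0 sub0r.
  rewrite -!/(D _) IH1 IH2 {}f1 {}f2 {}f3.
  have := W_rec m.+1 x; rewrite /E !big_ord_recr /= -[m.+1%:R]natr1.
  set p := \prod_(i < m) _; set w2 := (W m.+2).[x].
  set c := _ ^+ 2 + _ ^+ 2 => e.
  have -> : (p * (m%:R + 1) * (m%:R + 1 + 1)) ^+ 2 * w2 =
    (p * (m%:R + 1)) ^+ 2 * ((m%:R + 1 + 1) ^+ 2 * w2) by ring.
  by rewrite e /c; ring.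
have detV : \det V = \prod_(i < n) (i%:R + 1).
  rewrite -det_tr det_trig.
    apply: eq_bigr => i _; rewrite !mxE /v eqxx.
    by rewrite (_ : i.+1 == i = false) ?subr0 ?mulr1 // gtn_eqF.
  apply/is_trig_mxP => i j ij; rewrite !mxE /v.
  by rewrite [_ == _]gtn_eqF // [_.+1 == _]gtn_eqF ?subrr ?mulr0 // ltnW.
have p0 : \prod_(i < n) (i%:R + 1 : R) != 0.
  by apply/prodf_neq0 => i _; exact: natr1_neq0.
apply: (mulfI (expf_neq0 2 p0)).
rewrite -detf -VVf -VV !det_mulmx det_tr detV; ring.
Qed.

End CharacteristicPolynomials.

(** * The constant kappa and the harmonic numbers *)

Section Asymptotics.
Context (R : realType).
Implicit Types n m k : nat.
Local Notation b := (cb R).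
Local Notation H := (harm R).
Local Notation O := (odd_harm R).

(** The common limit of the decreasing sequence (n + 1/2) b_n^2 and of the
  increasing sequence (n + 1/4) b_n^2. *)
Definition kap : R := inf [set (n%:R + 1 / 2) * b n ^+ 2 | n in [set: nat]].

Lemma cb_sq n : (n%:R + 1) ^+ 2 * b n.+1 ^+ 2 = (n%:R + 1 / 2) ^+ 2 * b n ^+ 2.
Proof. by rewrite -!exprMn cbS. Qed.

Lemma cb_up_step n :
  (n.+1%:R + 1 / 2) * b n.+1 ^+ 2 <= (n%:R + 1 / 2) * b n ^+ 2.
Proof.
have n0 := ler0n R n; have c0 : 0 < b n ^+ 2 by rewrite exprn_gt0 ?cb_gt0.
have n1 : 0 < (n%:R + 1 : R) ^+ 2 by rewrite exprn_gt0 //; lra.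
rewrite -(ler_pM2l n1) -[n.+1%:R]natr1.
rewrite mulrCA cb_sq.
have : 0 <= (n%:R + 1 / 2) * b n ^+ 2 by rewrite mulr_ge0 ?ltW //; lra.
by lra.
Qed.

Lemma cb_lo_step n :
  (n%:R + 1 / 4) * b n ^+ 2 <= (n.+1%:R + 1 / 4) * b n.+1 ^+ 2.
Proof.
have n0 := ler0n R n; have c0 : 0 < b n ^+ 2 by rewrite exprn_gt0 ?cb_gt0.
have n1 : 0 < (n%:R + 1 : R) ^+ 2 by rewrite exprn_gt0 //; lra.
rewrite -(ler_pM2l n1) -[n.+1%:R]natr1.
rewrite [leRHS]mulrCA cb_sq.
by lra.
Qed.

Lemma cb_lo_le_up n m : (m%:R + 1 / 4) * b m ^+ 2 <= (n%:R + 1 / 2) * b n ^+ 2.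
Proof.
have h k : (k%:R + 1 / 4) * b k ^+ 2 <= (k%:R + 1 / 2) * b k ^+ 2.
  by rewrite ler_wpM2r ?exprn_ge0 ?ltW ?cb_gt0 //; lra.
have up k j : (k%:R + 1 / 2 + j%:R) * b (k + j) ^+ 2 <= (k%:R + 1 / 2) * b k ^+ 2.
  elim: j => [|j IH]; first by rewrite addr0 addn0.
  apply: le_trans IH; have := cb_up_step (k + j); rewrite addnS -!natr1 natrD.
  by lra.
have lo k j : (k%:R + 1 / 4) * b k ^+ 2 <= (k%:R + 1 / 4 + j%:R) * b (k + j) ^+ 2.
  elim: j => [|j IH]; first by rewrite addr0 addn0.
  apply: le_trans IH _; have := cb_lo_step (k + j); rewrite addnS -!natr1 natrD.
  by lra.
case: (leqP m n) => [|/ltnW] mn.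
  apply: le_trans (h n); have := lo m (n - m)%N.
  by rewrite subnKC // addrAC -natrD subnKC.
apply: le_trans (h m) _; have := up n (m - n)%N.
by rewrite subnKC // addrAC -natrD subnKC.
Qed.

Lemma kap_le n : kap <= (n%:R + 1 / 2) * b n ^+ 2.
Proof.
apply: ge_inf; last by exists n.
by exists ((0%:R + 1 / 4) * b 0 ^+ 2) => _ [m _ <-]; exact: cb_lo_le_up.
Qed.

Lemma kap_ge n : (n%:R + 1 / 4) * b n ^+ 2 <= kap.
Proof.
apply: lb_le_inf; first by exists ((0%:R + 1 / 2) * b 0 ^+ 2), 0%N.
by move=> _ [m _ <-]; exact: cb_lo_le_up.
Qed.

Lemma kap_ge14 : 1 / 4 <= kap.
Proof. by have := kap_ge 0; rewrite expr1n add0r mulr1. Qed.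

Lemma kap_gt0 : 0 < kap. Proof. by have := kap_ge14; lra. Qed.

Lemma kap_le12 : kap <= 1 / 2.
Proof. by have := kap_le 0; rewrite expr1n add0r mulr1. Qed.

Lemma harmS n : H n.+1 = H n + (n%:R + 1)^-1.
Proof. by rewrite /harm big_ord_recr. Qed.

Lemma harm_ge0 n : 0 <= H n.
Proof.
by apply: sumr_ge0 => k _; rewrite invr_ge0; have := ler0n R k; lra.
Qed.

Lemma harm_le n : H n <= n%:R.
Proof.
elim: n => [|n IH]; first by rewrite /harm big_ord0.
rewrite harmS -natr1 lerD // invf_le1; by have := ler0n R n; lra.
Qed.

Lemma le_harm n m : (n <= m)%N -> H n <= H m.
Proof.
move=> /subnKC <-; elim: (m - n)%N => [|k IH]; first by rewrite addn0.
apply: le_trans IH _; rewrite addnS harmS lerDl invr_ge0.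
by have := ler0n R (n + k); lra.
Qed.

Lemma harm_double n : H n.*2 - H n <= 1.
Proof.
case: n => [|n]; first by rewrite /harm big_ord0 subr0.
suff: forall k, H (n.+1 + k) - H n.+1 <= k%:R / n.+1%:R.
  by move/(_ n.+1); rewrite addnn divff // pnatr_eq0.
elim=> [|k IH]; first by rewrite addn0 subrr mul0r.
rewrite addnS harmS -[k.+1%:R]natr1 [leRHS]mulrDl addrAC lerD // mul1r.
have k0 := ler0n R k; have n0 : 0 < n.+1%:R :> R by rewrite ltr0n.
rewrite natrD; move: (n.+1%:R) n0 => x x0.
by rewrite lef_pV2 ?posrE //; lra.
Qed.

Lemma odd_harm_le n : O n <= H n + 2.
Proof.
rewrite /odd_harm; case: n => [|n]; first by rewrite big_ord0 addr_ge0 ?harm_ge0.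
rewrite big_ord_recl /= add0r addrC lerD //; last by lra.
rewrite /harm big_ord_recr /= -[leLHS]addr0 lerD //.
apply: ler_sum => k _; rewrite /bump /= add1n -natr1.
by have := ler0n R k => k0; rewrite lef_pV2 ?posrE; lra.
Qed.

Lemma ln_step n : (0 < n)%N ->
  (n%:R + 1)^-1 <= ln (n%:R + 1 : R) - ln n%:R <= (n%:R^-1 : R).
Proof.
rewrite -(ltr0n R); move: n%:R => x x0.
have x1 : 0 < x + 1 by lra.
rewrite -ln_div ?posrE //; apply/andP; split; last first.
  have -> : (x + 1) / x = 1 + x^-1 by field; lra.
  by apply: le_ln1Dx; rewrite (lt_trans _ (_ : 0 < _)) ?invr_gt0.
rewrite -lerN2 -lnV ?posrE ?divr_gt0 // invf_div.
have -> : x / (x + 1) = 1 + - (x + 1)^-1 by field; lra.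
by apply: le_ln1Dx; rewrite ltrN2 invf_lt1 //; lra.
Qed.

(** The sequence H_n - ln n decreases while H_n - ln (n+1) increases. *)
Lemma harm_ln_gamma n : (0 < n)%N ->
  `|H n - ln n%:R - euler_gamma R| <= n%:R^-1.
Proof.
pose u k : R := H k.+1 - ln (k%:R + 1).
pose v k : R := H k.+1 - ln (k%:R + 2).
have uS k : u k.+1 <= u k.
  have := ln_step (ltn0Sn k); rewrite -natr1 /u harmS -natr1 => /andP[+ _].
  by lra.
have vS k : v k <= v k.+1.
  have := ln_step (ltn0Sn k.+1).
  rewrite -[k.+2%:R]natr1 -[k.+1%:R]natr1 /v [H k.+2]harmS -[k.+1%:R]natr1.
  have -> : k%:R + 1 + 1 + 1 = k%:R + 1 + 2 :> R by ring.
  have -> : k%:R + 1 + 1 = k%:R + 2 :> R by ring.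
  move=> /andP[_].
  have := ln_step (ltn0Sn k); rewrite -[k.+1%:R]natr1.
  by lra.
have vu k : v k <= u k <= v k + (k%:R + 1)^-1.
  have := ln_step (ltn0Sn k); rewrite -[k.+1%:R]natr1 /u /v.
  have -> : k%:R + 1 + 1 = k%:R + 2 :> R by ring.
  have : 0 <= (k%:R + 2 : R)^-1 by rewrite invr_ge0; have := ler0n R k; lra.
  by move=> h /andP[h1 h2]; apply/andP; split; lra.
have uD k j : u (k + j)%N <= u k.
  elim: j => [|j IH]; first by rewrite addn0.
  by apply: le_trans IH; rewrite addnS.
have vD k j : v k <= v (k + j)%N.
  elim: j => [|j IH]; first by rewrite addn0.
  by apply: le_trans IH _; rewrite addnS.
have vu2 k j : v k <= u j.
  apply: le_trans (vD k j) _; rewrite addnC.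
  by apply: le_trans (uD j k); case/andP: (vu (j + k)%N).
pose g := sup [set v k | k in [set: nat]].
have gu k : g <= u k.
  apply: ge_sup; first by exists (v 0%N), 0%N.
  by move=> _ [j _ <-].
have vg k : v k <= g.
  apply: ub_le_sup; last by exists k.
  by exists (u 0%N) => _ [j _ <-].
have bnd k : (0 < k)%N -> `|H k - ln k%:R - g| <= k%:R^-1.
  case: k => // k _; rewrite -natr1 -/(u k) ger0_norm ?subr_ge0 //.
  by have := vg k; have := vu k => /andP[_ h1] h2; lra.
suff -> : euler_gamma R = g by exact: bnd.
rewrite /euler_gamma; apply/cvg_lim => //.
have -> : (fun k : nat => \sum_(1 <= i < k.+1) i%:R^-1 - ln (k%:R : R)) =
    (fun k => H k - ln k%:R).
  apply/funext => k; congr (_ - _).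
  by rewrite big_add1 /= big_mkord; apply: eq_bigr => i _; rewrite natr1.
apply/cvgrPdist_le => e e0.
have := @cvg_harmonic R => /cvgrPdist_le /(_ _ e0)[N _ hN].
exists N.+1 => // k /=; case: k => // k; rewrite ltnS => /hN /=.
rewrite sub0r normrN gtr0_norm ?invr_gt0 ?ltr0n // => hk.
by rewrite distrC (le_trans (bnd _ _)).
Qed.

End Asymptotics.

(** * Logarithmic growth at t = 0 *)

Section LogarithmicSolution.
Context (R : realType).
Implicit Types n m k : nat.
Local Notation b := (cb R).
Local Notation H := (harm R).
Local Notation O := (odd_harm R).
Local Notation kap := (kap R).

(** The solution at t = 0, divided by b_n and normalized so as to be equivalent to
  the logarithm. *)
Definition ell n : R := crit R n / (kap * b n).

Lemma ell_gt0 n : 0 < ell n.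
Proof. by rewrite divr_gt0 ?mulr_gt0 ?crit_gt0 ?cb_gt0 ?kap_gt0. Qed.

Lemma cb_le_step n : b n.+1 <= b n.
Proof.
have n0 := ler0n R n; have n1 : 0 < n%:R + 1 :> R by lra.
rewrite -(ler_pM2l n1) cbS ler_wpM2r ?ltW ?cb_gt0 //; lra.
Qed.

Lemma cb_le n m : (n <= m)%N -> b m <= b n.
Proof.
move=> /subnKC <-; elim: (m - n)%N => [|k IH]; first by rewrite addn0.
by rewrite addnS (le_trans (cb_le_step _)).
Qed.

Lemma le_ncb n m : (n <= m)%N -> n%:R * b n <= m%:R * b m.
Proof.
move=> /subnKC <-; elim: (m - n)%N => [|k IH]; first by rewrite addn0.
rewrite addnS -natr1 cbS (le_trans IH) // ler_wpM2r ?ltW ?cb_gt0 //; lra.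
Qed.

(** The size of the errors eps_k = b_k^2 - kappa/k. *)
Lemma eps_bound k : `|b k.+1 ^+ 2 - kap / (k%:R + 1)| <= kap / (2 * (k%:R + 1) ^+ 2).
Proof.
have k0 := ler0n R k; have K := kap_gt0 R.
have h1 := kap_le R k.+1; have h2 := kap_ge R k.+1.
rewrite -natr1 in h1 h2; set c := b k.+1 ^+ 2 in h1 h2 *.
have x0 : 0 < k%:R + 1 :> R by lra.
move: (k%:R + 1) x0 h1 h2 => x x0 h1 h2.
have c0 : 0 <= c by rewrite exprn_ge0 // ltW // cb_gt0.
have cx : c * x <= kap by lra.
have cx2 : c <= kap / x by rewrite ler_pdivlMr.
have h3 : kap / x <= c + c / (2 * x).
  rewrite ler_pdivrMr // mulrDl [c / (2 * x)]mulrC.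
  have -> : (2 * x)^-1 * c * x = c / 2 by field; lra.
  by lra.
have h4 : c / (2 * x) <= kap / (2 * x ^+ 2).
  have -> : kap / (2 * x ^+ 2) = kap / x / (2 * x) by field; lra.
  by rewrite ler_wpM2r // invr_ge0; lra.
by rewrite ler_norml; apply/andP; split; lra.
Qed.

(** Both kappa ell_n and 2 n b_n^2 O_n, where O_n is the sum of the 1/(k + 1/2), are
  explicit up to a weighted sum of the eps_k ([eX] and [eY] in the proof). The
  two families of weights differ by at most k/(n-k), so that the two sums,
  although unknown, are equal up to O(H_n / n). *)
Lemma ell_harm n : `|ell n.+1 - (3 * O n.+1 - 2 * H n.+1)| <=
  (2 * H n.+1 + 5) / n.+1%:R.
Proof.
have K := kap_gt0 R; have bn := cb_gt0 R n.+1; have n0 := ler0n R n.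
pose eps k : R := b k.+1 ^+ 2 - kap / (k%:R + 1).
pose X := \sum_(i < n.+1) b (n - i) / b n.+1 * eps i.
pose Y := \sum_(i < n) n.+1%:R / (n - i)%:R * eps i.
have eX : kap * ell n.+1 = 1 + kap * O n.+1 + X.
  have -> : kap * ell n.+1 = crit R n.+1 / b n.+1.
    by rewrite /ell; field; rewrite !gt_eqF.
  rewrite /crit big_ord_recl /= ?subn0 cb0 expr1n mulr1 mulrDl divff ?gt_eqF // -addrA.
  congr (1 + _); have -> : O n.+1 = (b n.+1 * O n.+1) / b n.+1.
    by field; rewrite gt_eqF.
  have <- : \sum_(i < n.+1) b (n - i) / (i%:R + 1) = b n.+1 * O n.+1.
    rewrite -conv_cb_inv (reindex_inj rev_ord_inj) /=; apply: eq_bigr => i _.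
    have hi : (i <= n)%N by rewrite -ltnS.
    rewrite subSS subKn //; congr (_ / _).
    by rewrite natr1 -subSn ?leq_subr // subKn // ltnW.
  rewrite mulrA mulr_sumr !mulr_suml.
  rewrite -big_split /=; apply: eq_bigr => i _; rewrite /bump /= add1n subSS.
  rewrite /eps; field.
  by rewrite gt_eqF //= gt_eqF //; have := ler0n R i; lra.
have eY : 2 * n.+1%:R * b n.+1 ^+ 2 * O n.+1 = 1 + 2 * kap * H n + Y.
  have -> : 2 * n.+1%:R * b n.+1 ^+ 2 * O n.+1 =
      n.+1%:R * (2 * b n.+1 ^+ 2 * O n.+1) by ring.
  rewrite -conv_cb2_inv big_ord_recl /= ?subn0 cb0 expr1n mulrDr mul1r divff ?pnatr_eq0 //.
  rewrite -addrA; congr (1 + _).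
  have -> : 2 * kap * H n = kap * \sum_(i < n) (n - i)%:R^-1 + kap * H n.
    suff -> : \sum_(i < n) (n - i)%:R^-1 = H n by ring.
    rewrite (reindex_inj rev_ord_inj) /=; apply: eq_bigr => i _.
    by rewrite subKn ?natr1.
  rewrite -mulrDr -big_split /= mulr_sumr mulr_sumr -big_split /=.
  apply: eq_bigr => i _; rewrite /bump /= add1n subSS /eps.
  have hi : (i < n)%N by [].
  have i0 := ler0n R i.
  have -> : n.+1%:R = (n - i)%:R + i%:R + 1 :> R.
    by rewrite -natrD subnK ?natr1 // ltnW.
  have d0 : 0 < (n - i)%:R :> R by rewrite ltr0n subn_gt0.
  move: (n - i)%:R d0 => d d0; field.
  by rewrite gt_eqF //= gt_eqF //; lra.
have eXY : X - Y = eps n / b n.+1 +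
    \sum_(i < n) (b (n - i) / b n.+1 - n.+1%:R / (n - i)%:R) * eps i.
  rewrite /X big_ord_recr /= subnn cb0 mul1r addrAC addrC [_^-1 * _]mulrC.
  congr (_ + _).
  by rewrite -sumrB; apply: eq_bigr => i _; rewrite mulrBl.
have bXY : `|X - Y| <= kap * (H n + 1) / n.+1%:R.
  have ns : 0 < n.+1%:R :> R by rewrite ltr0n.
  have nb : 1 / 2 <= n.+1%:R * b n.+1.
    by have := le_ncb (ltn0Sn n); rewrite cb1; lra.
  have -> : kap * (H n + 1) / n.+1%:R = kap / n.+1%:R + kap * H n / n.+1%:R by ring.
  rewrite eXY; apply: le_trans (ler_normD _ _) (lerD _ _).
    rewrite normrM [`|_^-1|]gtr0_norm ?invr_gt0 // ler_pdivrMr //.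
    apply: le_trans (eps_bound n) _; rewrite natr1.
    rewrite ler_pdivrMr; last by rewrite mulr_gt0 // exprn_gt0.
    have -> : kap / n.+1%:R * b n.+1 * (2 * n.+1%:R ^+ 2) =
       kap * (2 * (n.+1%:R * b n.+1)) by field; rewrite gt_eqF.
    apply: ler_peMr; [exact: ltW | lra].
  apply: le_trans (ler_norm_sum _ _ _) _.
  apply: (@le_trans _ _ (\sum_(i < n) kap / (2 * n.+1%:R) * ((n - i)%:R^-1 + (i%:R + 1)^-1))).
    apply: ler_sum => i _; rewrite normrM.
    have hi : (i < n)%N by [].
    have i0 := ler0n R i.
    have d0 : 0 < (n - i)%:R :> R by rewrite ltr0n subn_gt0.
    have dn : (n - i <= n.+1)%N by rewrite leqW // leq_subr.
    have w1 : 1 <= b (n - i) / b n.+1 by rewrite ler_pdivlMr // mul1r cb_le.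
    have w2 : b (n - i) / b n.+1 <= n.+1%:R / (n - i)%:R.
      by rewrite ler_pdivrMr // mulrAC ler_pdivlMr // mulrC le_ncb.
    have en : n.+1%:R = (n - i)%:R + (i%:R + 1) :> R.
      by rewrite addrA -natrD subnK ?natr1 // ltnW.
    have w3 : `|b (n - i) / b n.+1 - n.+1%:R / (n - i)%:R| <= (i%:R + 1) / (n - i)%:R.
      have : n.+1%:R / (n - i)%:R = 1 + (i%:R + 1) / (n - i)%:R :> R.
        by rewrite en; field; rewrite gt_eqF.
      by move=> e; rewrite ler_norml; apply/andP; split; lra.
    apply: le_trans (ler_pM _ _ w3 (eps_bound i)) _ => //.
    have y0 : 0 < i%:R + 1 :> R by lra.
    rewrite en; move: (n - i)%:R (i%:R + 1) d0 y0 => d y d0 y0.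
    rewrite le_eqVlt; apply/orP; left; apply/eqP; field.
    by repeat (apply/andP; split); rewrite ?gt_eqF //; lra.
  rewrite -mulr_sumr big_split /= -/(harm R n).
  have -> : \sum_(i < n) (n - i)%:R^-1 = H n.
    rewrite (reindex_inj rev_ord_inj) /=; apply: eq_bigr => i _.
    by rewrite subKn ?natr1.
  by rewrite le_eqVlt; apply/orP; left; apply/eqP; field; rewrite gt_eqF.
have HS := harmS R n; have hO := odd_harm_le R n.+1.
have Hn := harm_ge0 R n.
have h1 := kap_le R n.+1; have h2 := kap_ge R n.+1.
have O0 : 0 <= O n.+1.
  by apply: sumr_ge0 => k _; rewrite invr_ge0; have := ler0n R k; lra.
have b2 : 0 < b n.+1 ^+ 2 by rewrite exprn_gt0.
rewrite natr1 in HS.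
have N0 : 0 < n.+1%:R :> R by rewrite ltr0n.
move: (n.+1%:R) N0 HS h1 h2 eY bXY => N N0 HS h1 h2 eY bXY.
rewrite -(ler_pM2l K) -[X in X * `|_|]gtr0_norm // -normrM.
have -> : kap * (ell n.+1 - (3 * O n.+1 - 2 * H n.+1)) =
    (2 * N * b n.+1 ^+ 2 - 2 * kap) * O n.+1 + (X - Y) + 2 * kap / N.
  have -> : 2 * kap / N = 2 * kap * (H n.+1 - H n) by rewrite HS; ring.
  rewrite mulrBr eX mulrBl eY; ring.
have c1 : `|(2 * N * b n.+1 ^+ 2 - 2 * kap) * O n.+1| <= kap * O n.+1 / N.
  rewrite normrM [`|O _|]ger0_norm //.
  have -> : kap * O n.+1 / N = kap / N * O n.+1 by ring.
  rewrite ler_wpM2r //.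
  have : b n.+1 ^+ 2 <= kap / N by rewrite ler_pdivlMr //; lra.
  by rewrite ler_norml => h; apply/andP; split; lra.
have c2 : `|2 * kap / N| = 2 * kap / N by rewrite gtr0_norm // divr_gt0 //; lra.
apply: le_trans (ler_normD _ _) _; rewrite c2.
apply: (@le_trans _ _ (kap * O n.+1 / N + kap * (H n + 1) / N + 2 * kap / N)).
  rewrite lerD2r; apply: le_trans (ler_normD _ _) _; exact: lerD.
rewrite mulrA -!mulrDl ler_pM2r ?invr_gt0 //.
have : kap * O n.+1 <= kap * (H n.+1 + 2) by rewrite ler_pM2l.
have : kap * H n <= kap * H n.+1 by rewrite ler_pM2l // HS lerDl invr_ge0 ltW.
by lra.
Qed.

End LogarithmicSolution.

(** * Self-adjoint form of the recurrence *)

Section Flux.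
Context (R : realType).
Implicit Types n m k : nat.
Local Notation b := (cb R).
Local Notation H := (harm R).
Local Notation kap := (kap R).
Local Notation ell := (ell R).

Lemma ell_lin n :
  `|ell n.+1 - (6 * H n.+1.*2 - 5 * H n.+1)| <= (2 * H n.+1 + 5) / n.+1%:R.
Proof.
have := ell_harm R n; rewrite odd_harmE.
by have -> : 6 * H n.+1.*2 - 5 * H n.+1 = 3 * (2 * H n.+1.*2 - H n.+1) - 2 * H n.+1
  by ring.
Qed.

Lemma ell_ln n : `|ell n.+1 - (ln n.+1%:R + (euler_gamma R + 6 * ln 2))| <=
  (2 * H n.+1 + 13) / n.+1%:R.
Proof.
have h1 := ell_lin n.
have h2 := harm_ln_gamma R (ltn0Sn n).
have h3 : `|H n.+1.*2 - ln n.+1.*2%:R - euler_gamma R| <= n.+1.*2%:R^-1.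
  exact: harm_ln_gamma.
rewrite -muln2 natrM lnM ?posrE ?ltr0n // in h3.
rewrite muln2 invfM in h3.
have : 0 <= n.+1%:R^-1 :> R by rewrite invr_ge0.
move: (n.+1%:R^-1) h1 h2 h3 => y.
rewrite !ler_norml => /andP[a1 a2] /andP[b1 b2] /andP[c1 c2] y0.
by apply/andP; split; lra.
Qed.

Lemma ell0 : ell 0 = kap^-1.
Proof. by rewrite /ell /crit big_ord_recr big_ord0 /= cb0; field; rewrite gt_eqF ?kap_gt0. Qed.

Lemma ell_sub_harm n : `|ell n - H n| <= 13.
Proof.
case: n => [|n].
  rewrite ell0 /harm big_ord0 subr0 gtr0_norm ?invr_gt0 ?kap_gt0 //.
  by rewrite -[_^-1]mul1r ler_pdivrMr ?kap_gt0 //; have := kap_ge14 R; lra.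
have h1 := ell_lin n; have h2 := harm_double R n.+1.
have h3 : H n.+1 <= H n.+1.*2 by rewrite le_harm // -addnn leq_addr.
have h4 : (2 * H n.+1 + 5) / n.+1%:R <= 7.
  rewrite ler_pdivrMr ?ltr0n //; have := harm_le R n.+1.
  have : 1 <= n.+1%:R :> R by rewrite ler1n.
  by lra.
move: (le_trans h1 h4); rewrite !ler_norml => /andP[a1 a2].
by apply/andP; split; lra.
Qed.

Lemma harm_unbounded (M : R) : exists N, forall n, (N <= n)%N -> M <= H n.
Proof.
pose x := expR (M - euler_gamma R + 1).
have x0 : 0 < x by exact: expR_gt0.
exists (Num.trunc x).+1 => n hn.
have n0 : (0 < n)%N by exact: leq_trans hn.
have xn : x <= n%:R.
  apply: le_trans (ltW (truncnS_gt x)) _.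
  by rewrite ler_nat.
have := harm_ln_gamma R n0.
have : M - euler_gamma R + 1 <= ln n%:R.
  by rewrite -[leLHS]expRK ler_ln ?posrE ?ltr0n.
have : n%:R^-1 <= 1 :> R by rewrite invf_le1 ?ltr0n // ler1n.
by rewrite ler_norml => h1 h2 /andP[h3 h4]; lra.
Qed.

(** The fourth root of n + 1, in terms of which the error terms are bounded. *)
Definition rt n : R := Num.sqrt (Num.sqrt (n%:R + 1)).

Lemma rt4 n : rt n ^+ 4 = n%:R + 1.
Proof.
have n0 := ler0n R n.
by rewrite /rt (exprM _ 2 2) sqr_sqrtr ?sqrtr_ge0 // sqr_sqrtr //; lra.
Qed.

Lemma rt_ge1 n : 1 <= rt n.
Proof.
have n0 := ler0n R n.
by rewrite -[leLHS]sqrtr1 ler_wsqrtr // -[leLHS]sqrtr1 ler_wsqrtr //; lra.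
Qed.

Lemma rt_gt0 n : 0 < rt n.
Proof. by have := rt_ge1 n; lra. Qed.

Lemma le_rtS n : rt n <= rt n.+1.
Proof.
have n0 := ler0n R n.
by rewrite /rt -natr1 !ler_wsqrtr //; lra.
Qed.

Lemma rt_step n : 1 <= 4 * rt n.+1 ^+ 3 * (rt n.+1 - rt n).
Proof.
have := rt4 n.+1; rewrite -natr1 -rt4.
have := le_rtS n; have := rt_gt0 n; move: (rt n) (rt n.+1) => x y x0 xy e.
have : x ^+ 3 <= y ^+ 3 by rewrite lerXn2r // nnegrE; lra.
have : x ^+ 2 * y <= y ^+ 3 by rewrite [leRHS]exprSr ler_pM2r ?lerXn2r ?nnegrE; lra.
have : x * y ^+ 2 <= y ^+ 3 by rewrite [leRHS]exprS ler_pM2r ?exprn_gt0; lra.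
move=> h1 h2 h3.
have e1 : 1 = (y - x) * (y ^+ 3 + x * y ^+ 2 + x ^+ 2 * y + x ^+ 3).
  by rewrite -[LHS](addKr (x ^+ 4)) -e; ring.
have : (y - x) * (y ^+ 3 + x * y ^+ 2 + x ^+ 2 * y + x ^+ 3) <= (y - x) * (4 * y ^+ 3).
  by apply: ler_wpM2l; lra.
by rewrite -e1; lra.
Qed.

Lemma rt_lt2 n : rt n.+1 ^+ 4 <= 2 * rt n ^+ 4.
Proof. by rewrite !rt4 -natr1; have := ler0n R n; lra. Qed.

Lemma harm_rt n : H n <= 8 * rt n.
Proof.
elim: n => [|n IH].
  by rewrite /harm big_ord0 mulr_ge0 // ltW // rt_gt0.
rewrite harmS -rt4; have := rt_step n; have := rt_lt2 n.
have := rt_gt0 n; have := rt_ge1 n.+1; have := le_rtS n; move: IH.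
move: (rt n) (rt n.+1) => x y IH xy y1 x0 h1 h2.
have x4 : 0 < x ^+ 4 by rewrite exprn_gt0.
have h3 : y ^+ 3 <= y ^+ 4 by rewrite [leRHS]exprS ler_peMl // exprn_ge0; lra.
suff : (x ^+ 4)^-1 <= 8 * (y - x) by lra.
rewrite -[_^-1]mul1r ler_pdivrMr //; apply: (le_trans h2).
have -> : 8 * (y - x) * x ^+ 4 = 4 * (2 * x ^+ 4) * (y - x) by ring.
by apply: ler_wpM2r; lra.
Qed.

Lemma ell_rt n : ell n <= 21 * rt n.
Proof.
have := ell_sub_harm n; have := harm_rt n; have := rt_ge1 n.
by rewrite ler_norml => h1 h2 /andP[h3 h4]; lra.
Qed.

(** The weights of the self-adjoint form [gsol_rec] of the recurrence. *)
Definition qw n : R := (n%:R + 1) ^+ 2 * b n * b n.+1.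

Lemma qwE n : qw n = (n%:R + 1) * (n%:R + 1 / 2) * b n ^+ 2.
Proof.
have -> : qw n = (n%:R + 1) * b n * ((n%:R + 1) * b n.+1) by rewrite /qw; ring.
by rewrite cbS; ring.
Qed.

Lemma qw_ge n : kap * (n%:R + 1) <= qw n.
Proof.
have := kap_le R n; have := ler0n R n; rewrite qwE => n0 h.
by rewrite -mulrA mulrC ler_wpM2l //; lra.
Qed.

Lemma qw_le n : qw n <= kap * (n%:R + 2).
Proof.
have h := kap_ge R n; have n0 := ler0n R n; rewrite qwE.
have b0 : 0 < b n ^+ 2 by rewrite exprn_gt0 ?cb_gt0.
apply: le_trans (ler_wpM2r _ h); last by lra.
rewrite -mulrA mulrAC -mulrA; move: (b n ^+ 2) b0 => B B0 {h}.
suff : 0 <= B * ((n%:R + 1 / 4) * (n%:R + 2) - (n%:R + 1) * (n%:R + 1 / 2)) by lra.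
have n2 : 0 <= n%:R * n%:R :> R by rewrite mulr_ge0.
by apply: mulr_ge0; lra.
Qed.

Lemma qw_gt0 n : 0 < qw n.
Proof. by rewrite !mulr_gt0 ?cb_gt0 ?exprn_gt0 //; have := ler0n R n; lra. Qed.

(** The solution g_n = W_n / b_n. *)
Definition gsol n x : R := (W R n).[x] / b n.

Lemma gsol_rec n x :
  qw n.+1 * (gsol n.+2 x - gsol n.+1 x) - qw n * (gsol n.+1 x - gsol n x) =
  - (x - 1 / 4 + (8 * n%:R + 4)^-1) * b n.+1 ^+ 2 * gsol n.+1 x.
Proof.
have n0 := ler0n R n.
have := W_rec n.+1 x; rewrite /= => e.
have b2 : (n.+1%:R + 1) * b n.+2 = (n.+1%:R + 1 / 2) * b n.+1 by exact: cbS.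
have b1 : (n%:R + 1) * b n.+1 = (n%:R + 1 / 2) * b n by exact: cbS.
have p0 := cb_gt0 R n; have p1 := cb_gt0 R n.+1; have p2 := cb_gt0 R n.+2.
rewrite -[n.+1%:R]natr1 in e b2.
rewrite /qw /gsol -[n.+1%:R]natr1.
move: (W R n.+2).[x] (W R n.+1).[x] (W R n).[x] e => w2 w1 w0 e.
have -> : (n%:R + 1 + 1) ^+ 2 * b n.+1 * b n.+2 * (w2 / b n.+2 - w1 / b n.+1) =
   b n.+1 * ((n%:R + 1 + 1) ^+ 2 * w2)
   - (n%:R + 1 + 1) * ((n%:R + 1 + 1) * b n.+2) * w1.
  by field; rewrite !gt_eqF.
rewrite e b2.
have -> : b n = (n%:R + 1) * b n.+1 / (n%:R + 1 / 2) by rewrite b1; field; lra.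
by field; rewrite gt_eqF //= !gt_eqF //; lra.
Qed.

Lemma gsol0 x : gsol 0 x = 1.
Proof. by rewrite /gsol W0 cb0 -polyC1 hornerC divr1. Qed.

Lemma gsol1 x : gsol 1 x = 2 * (1 - x).
Proof. by rewrite /gsol W1 cb1; field. Qed.

Lemma gsol_crit n : gsol n (1 / 4) = kap * ell n.
Proof. by rewrite /gsol W_crit /ell; field; rewrite !gt_eqF ?cb_gt0 ?kap_gt0. Qed.

(** The flux of ell, the difference of two terms weighted by qw; it decreases to
  kappa. *)
Definition fl n : R := qw n * (ell n.+1 - ell n).

Lemma fl_rec n : fl n.+1 = fl n - (8 * n%:R + 4)^-1 * b n.+1 ^+ 2 * ell n.+1.
Proof.
have := gsol_rec n (1 / 4); rewrite !gsol_crit subrr add0r => e.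
apply: (mulfI (lt0r_neq0 (kap_gt0 R))); rewrite /fl.
by lra.
Qed.

Lemma fl0 : fl 0 = ell 0 / 4.
Proof.
have h : ell 1 = 3 / 2 * ell 0.
  rewrite ell0; have := gsol_crit 1; rewrite gsol1 => h.
  apply: (mulfI (lt0r_neq0 (kap_gt0 R))); rewrite -h.
  by field; rewrite gt_eqF ?kap_gt0.
by rewrite /fl h /qw add0r expr1n mul1r cb0 cb1; field.
Qed.

Lemma fl_le n m : (n <= m)%N -> fl m <= fl n.
Proof.
move=> /subnKC <-; elim: (m - n)%N => [|k IH]; first by rewrite addn0.
rewrite addnS fl_rec; apply: le_trans IH; rewrite gerBl.
apply: mulr_ge0; last by rewrite ltW ?ell_gt0.
apply: mulr_ge0; last by rewrite exprn_ge0 // ltW ?cb_gt0.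
by rewrite invr_ge0; have := ler0n R (n + k); lra.
Qed.

Lemma fl_le1 n : fl n <= 1.
Proof.
apply: le_trans (fl_le (leq0n n)) _; rewrite fl0 ell0.
by rewrite ler_pdivrMr // -[_^-1]mul1r ler_pdivrMr ?kap_gt0 //;
   have := kap_ge14 R; lra.
Qed.

Lemma ellS n : ell n.+1 = ell n + fl n / qw n.
Proof. by rewrite /fl; field; rewrite gt_eqF ?qw_gt0. Qed.

Lemma fl_decr n : fl n <= fl n.+1 + 22 / rt n.+1 ^+ 6.
Proof.
have n0 := ler0n R n; have y4 := rt4 n.+1; have y1 := rt_ge1 n.+1.
have h := ell_rt n.+1; have h0 := ell_gt0 R n.+1; have h2 := kap_ge R n.+1.
have k2 := kap_le12 R.
rewrite fl_rec; set y := rt n.+1 in y4 y1 h *.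
rewrite -natr1 in y4 h2.
have b0 : 0 < b n.+1 ^+ 2 by rewrite exprn_gt0 ?cb_gt0.
have y40 : 0 < y ^+ 4 by rewrite exprn_gt0; lra.
have hv : (8 * n%:R + 4)^-1 <= (y ^+ 4)^-1 by rewrite lef_pV2 ?posrE //; lra.
have hb : b n.+1 ^+ 2 <= (y ^+ 4)^-1.
  rewrite -[_^-1]mul1r ler_pdivlMr // y4.
  have : 0 <= n%:R * b n.+1 ^+ 2 by rewrite mulr_ge0 // ltW.
  by lra.
have : (8 * n%:R + 4)^-1 * b n.+1 ^+ 2 * ell n.+1 <= (y ^+ 4)^-1 * (y ^+ 4)^-1 * (21 * y).
  have v0 : 0 <= (8 * n%:R + 4 : R)^-1 by rewrite invr_ge0; lra.
  have b0' := ltW b0.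
  apply: ler_pM => //; [exact: mulr_ge0 | exact: ltW |].
  exact: ler_pM.
have : (y ^+ 4)^-1 * (y ^+ 4)^-1 * (21 * y) <= 22 / y ^+ 6.
  rewrite ler_pdivlMr ?exprn_gt0 //; last by lra.
  have -> : (y ^+ 4)^-1 * (y ^+ 4)^-1 * (21 * y) * y ^+ 6 = 21 / y by field; lra.
  by rewrite ler_pdivrMr; lra.
by lra.
Qed.

End Flux.

(** * The limit of the flux *)

Section FluxLimit.
Context (R : realType).
Implicit Types n m k : nat.
Local Notation H := (harm R).
Local Notation kap := (kap R).
Local Notation ell := (ell R).
Local Notation fl := (fl R).
Local Notation rt := (rt R).

(** If the flux went below kappa, then ell_n would grow more slowly than H_n by a
  constant factor, against [ell_sub_harm]. *)
Lemma fl_ge n : kap <= fl n.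
Proof.
rewrite leNgt; apply/negP => hn; have K := kap_gt0 R.
pose phi := Num.max (fl n) 0 / kap.
have phi1 : phi < 1 by rewrite ltr_pdivrMr // mul1r gt_max hn.
have phi0 : 0 <= phi by rewrite divr_ge0 ?le_max ?lexx ?orbT // ltW.
have step m : (n <= m)%N -> ell m.+1 <= ell m + phi * (m%:R + 1)^-1.
  move=> nm; rewrite ellS lerD2l.
  have m0 := ler0n R m; have qm := qw_gt0 R m; have qg := qw_ge R m.
  rewrite ler_pdivrMr //.
  have h1 : fl m <= phi * kap.
    rewrite /phi mulfVK ?gt_eqF //; apply: le_trans (fl_le R nm) _.
    by rewrite le_max lexx.
  have h2 : kap <= qw R m / (m%:R + 1) by rewrite ler_pdivlMr //; lra.
  apply: (le_trans h1).
  have -> : phi * (m%:R + 1)^-1 * qw R m = phi * (qw R m / (m%:R + 1)) by ring.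
  exact: ler_wpM2l.
have bnd m : (n <= m)%N -> ell m - phi * H m <= ell n - phi * H n.
  move=> /subnKC <-; elim: (m - n)%N => [|k IH]; first by rewrite addn0.
  apply: le_trans IH; have := step _ (leq_addr k n).
  by rewrite addnS harmS mulrDr; lra.
have [N hN] := harm_unbounded ((ell n - phi * H n + 14) / (1 - phi)).
have := hN _ (leq_maxl N n); rewrite ler_pdivrMr; last by lra.
have := bnd _ (leq_maxr N n).
have := ell_sub_harm R (maxn N n).
by rewrite ler_norml => /andP[h1 h2]; lra.
Qed.

Lemma rt2_step n : (rt n.+1 ^+ 6)^-1 <= 2 * ((rt n ^+ 2)^-1 - (rt n.+1 ^+ 2)^-1).
Proof.
have := rt4 R n.+1; rewrite -natr1 -rt4.
have := le_rtS R n; have := rt_gt0 R n; move: (rt n) (rt n.+1) => x y x0 xy e.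
have y0 : 0 < y by lra.
have -> : 2 * ((x ^+ 2)^-1 - (y ^+ 2)^-1) = 2 * ((y ^+ 2 - x ^+ 2) / (x ^+ 2 * y ^+ 2)).
  by field; rewrite !gt_eqF.
have p : 0 < (x ^+ 2 + y ^+ 2) by rewrite addr_gt0 ?exprn_gt0.
have -> : y ^+ 2 - x ^+ 2 = (x ^+ 2 + y ^+ 2)^-1.
  apply: (mulIf (lt0r_neq0 p)); rewrite mulVf ?gt_eqF //.
  by rewrite -[RHS](addKr (x ^+ 4)) -e; ring.
rewrite -invfM ler_pdivlMr; last by rewrite mulr_gt0 ?mulr_gt0 ?exprn_gt0.
rewrite mulrC ler_pdivrMr ?exprn_gt0 //.
have h : x ^+ 2 <= y ^+ 2 by rewrite lerXn2r // nnegrE; lra.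
have -> : 2 * y ^+ 6 = 2 * y ^+ 2 * (y ^+ 2 * y ^+ 2) by ring.
apply: ler_pM; rewrite ?mulr_ge0 ?exprn_ge0; try lra.
by apply: ler_wpM2r => //; rewrite exprn_ge0; lra.
Qed.

(** The flux minus 44 / sqrt (n+1) increases; were it ever above kappa, then ell_n
  would grow faster than H_n by a constant factor. *)
Lemma fl_upper n : fl n <= kap + 44 / rt n ^+ 2.
Proof.
rewrite leNgt; apply/negP => hn; have K := kap_gt0 R.
have mono m : fl m - 44 / rt m ^+ 2 <= fl m.+1 - 44 / rt m.+1 ^+ 2.
  by have := fl_decr R m; have := rt2_step m; lra.
have low m : (n <= m)%N -> fl n - 44 / rt n ^+ 2 <= fl m.
  move=> nm; apply: (@le_trans _ _ (fl m - 44 / rt m ^+ 2)).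
    move: nm => /subnKC <-; elim: (m - n)%N => [|k IH]; first by rewrite addn0.
    by apply: le_trans IH _; rewrite addnS.
  by rewrite gerBl divr_ge0 // exprn_ge0 // ltW // rt_gt0.
pose phi := (fl n - 44 / rt n ^+ 2) / kap.
have phi1 : 1 < phi by rewrite ltr_pdivlMr // mul1r; lra.
have step m : (n <= m)%N -> ell m + phi * (m.+1%:R + 1)^-1 <= ell m.+1.
  move=> nm; rewrite ellS lerD2l -natr1.
  have m0 := ler0n R m; have qm := qw_gt0 R m; have qg := qw_le R m.
  rewrite ler_pdivlMr //.
  have h1 : phi * kap <= fl m by rewrite /phi mulfVK ?gt_eqF // low.
  have h2 : qw R m / (m%:R + 1 + 1) <= kap by rewrite ler_pdivrMr; lra.
  apply: le_trans h1.
  have -> : phi * (m%:R + 1 + 1)^-1 * qw R m = phi * (qw R m / (m%:R + 1 + 1)) by ring.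
  by apply: ler_wpM2l => //; lra.
have bnd m : (n <= m)%N -> ell n - phi * H n.+1 <= ell m - phi * H m.+1.
  move=> /subnKC <-; elim: (m - n)%N => [|k IH]; first by rewrite addn0.
  apply: le_trans IH _; have := step _ (leq_addr k n).
  by rewrite addnS [H (n + k).+2]harmS mulrDr; lra.
have [N hN] := harm_unbounded ((phi * H n.+1 - ell n + 14) / (phi - 1)).
have := hN _ (leq_maxl N n); rewrite ler_pdivrMr; last by lra.
have := bnd _ (leq_maxr N n).
have := ell_sub_harm R (maxn N n).
have : H (maxn N n) <= H (maxn N n).+1 by rewrite le_harm.
have := harm_ge0 R (maxn N n).
rewrite ler_norml => h0 h3 /andP[h1 h2] h4 h5.
have : phi * H (maxn N n) <= phi * H (maxn N n).+1 by rewrite ler_wpM2l //; lra.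
by lra.
Qed.

Lemma ell_stepE n : ell n.+1 - ell n = fl n / qw R n.
Proof. by rewrite ellS addrC addKr. Qed.

Lemma ell_step_gt0 n : 0 < ell n.+1 - ell n.
Proof.
rewrite ell_stepE divr_gt0 ?qw_gt0 //.
by apply: lt_le_trans (fl_ge n); rewrite kap_gt0.
Qed.

Lemma ell_step_le n : ell n.+1 - ell n <= 4 / rt n ^+ 4.
Proof.
rewrite ell_stepE rt4; have n0 := ler0n R n; have h := qw_ge R n.
have := fl_le1 R n; have K := kap_ge14 R => f1.
rewrite ler_pdivrMr ?qw_gt0 // mulrAC ler_pdivlMr; last by lra.
have : 0 <= n%:R * (kap - 1 / 4) by rewrite mulr_ge0 //; lra.
have : fl n * (n%:R + 1) <= n%:R + 1 by rewrite ler_piMl //; lra.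
by lra.
Qed.

End FluxLimit.

(** * Taylor bounds for sine and cosine *)

Section TrigBounds.
Context (R : realType).
Implicit Types x : R.

Lemma nonneg_of_derive (F f : R -> R) : F 0 = 0 ->
  (forall x, is_derive x 1 F (f x)) -> (forall x, 0 <= x -> 0 <= f x) ->
  forall x, 0 <= x -> 0 <= F x.
Proof.
move=> F0 dF f0 x; rewrite le_eqVlt => /orP[/eqP<-|x0]; first by rewrite F0.
have cF : {within `[0, x], continuous F}.
  apply: derivable_within_continuous => y _.
  exact: (@ex_derive _ _ _ _ _ _ _ (dF y)).
have [c /itvP hc] := MVT x0 (fun y _ => dF y) cF.
by rewrite F0 !subr0 => ->; rewrite mulr_ge0 ?f0 ?hc // ltW.
Qed.

Lemma sin_le_id x : 0 <= x -> sin x <= x.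
Proof.
move=> x0; rewrite -subr_ge0.
suff: 0 <= (horner 'X - sin) x by rewrite !fctE /= hornerX.
apply: (nonneg_of_derive (F := horner 'X - sin) (f := fun y => (deriv 'X).[y] - cos y)) x0.
- by rewrite !fctE hornerX sin0 subr0.
- by move=> y _; rewrite derivX -polyC1 hornerC subr_ge0 cos_le1.
Qed.

Lemma cos_ge_quad x : 0 <= x -> 1 - x ^+ 2 / 2 <= cos x.
Proof.
move=> x0; rewrite -subr_ge0.
pose p : {poly R} := 1%:P - 2^-1 *: 'X^2.
have pE y : p.[y] = 1 - y ^+ 2 / 2.
  by rewrite /p !(hornerD, hornerN, hornerC, hornerZ, hornerXn) mulrC.
suff: 0 <= (cos - horner p) x by rewrite !fctE /= pE.
apply: (nonneg_of_derive (F := cos - horner p) (f := fun y => - sin y - p^`().[y])) x0.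
- by rewrite !fctE pE cos0; ring.
- move=> y y0; have := sin_le_id y0.
  rewrite /p derivB derivC derivZ derivXn !(hornerD, hornerN, hornerC, hornerZ, hornerMn, hornerXn) /=.
  by lra.
Qed.

Lemma sin_ge_cubic x : 0 <= x -> x - x ^+ 3 / 6 <= sin x.
Proof.
move=> x0; rewrite -subr_ge0.
pose p : {poly R} := 'X - 6^-1 *: 'X^3.
have pE y : p.[y] = y - y ^+ 3 / 6.
  by rewrite /p !(hornerD, hornerN, hornerX, hornerZ, hornerXn) mulrC.
suff: 0 <= (sin - horner p) x by rewrite !fctE /= pE.
apply: (nonneg_of_derive (F := sin - horner p) (f := fun y => cos y - p^`().[y])) x0.
- by rewrite !fctE pE sin0; ring.
- move=> y y0; have := cos_ge_quad y0.
  rewrite /p derivB derivX derivZ derivXn -polyC1 !(hornerD, hornerN, hornerC, hornerZ, hornerMn, hornerXn) /=.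
  by lra.
Qed.

Lemma cos_le_quartic x : 0 <= x -> cos x <= 1 - x ^+ 2 / 2 + x ^+ 4 / 24.
Proof.
move=> x0; rewrite -subr_ge0.
pose p : {poly R} := 1%:P - 2^-1 *: 'X^2 + 24^-1 *: 'X^4.
have pE y : p.[y] = 1 - y ^+ 2 / 2 + y ^+ 4 / 24.
  by rewrite /p !(hornerD, hornerN, hornerC, hornerZ, hornerXn); ring.
suff: 0 <= (horner p - cos) x by rewrite !fctE /= pE.
apply: (nonneg_of_derive (F := horner p - cos) (f := fun y => p^`().[y] - (- sin y))) x0.
- by rewrite !fctE pE cos0; ring.
- move=> y y0; have := sin_ge_cubic y0.
  rewrite /p derivD derivB derivC !derivZ !derivXn !(hornerD, hornerN, hornerC, hornerZ, hornerMn, hornerXn) /=.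
  by lra.
Qed.

Lemma sin_sub_id x : 0 <= x -> `|sin x - x| <= x ^+ 3 / 6.
Proof.
move=> x0; have := sin_le_id x0; have := sin_ge_cubic x0.
have : 0 <= x ^+ 3 by rewrite exprn_ge0.
by rewrite ler_norml => h1 h2 h3; apply/andP; split; lra.
Qed.

Lemma cos_sub_quad x : 0 <= x <= 4 -> `|cos x - (1 - x ^+ 2 / 2)| <= x ^+ 3 / 6.
Proof.
move=> /andP[x0 x4]; have := cos_ge_quad x0; have := cos_le_quartic x0.
have h : 0 <= x ^+ 3 by rewrite exprn_ge0.
have : x ^+ 4 <= 4 * x ^+ 3 by rewrite exprS ler_wpM2r.
by rewrite ler_norml => h1 h2 h3; apply/andP; split; lra.
Qed.

Lemma sin_sub_xcos x : 0 <= x -> `|sin x - x * cos x| <= x ^+ 3.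
Proof.
move=> x0; have := sin_le_id x0; have := sin_ge_cubic x0.
have h : 0 <= x ^+ 3 by rewrite exprn_ge0.
have : x * (1 - x ^+ 2 / 2) <= x * cos x by rewrite ler_wpM2l ?cos_ge_quad.
have : x * cos x <= x * 1 by rewrite ler_wpM2l ?cos_le1.
rewrite exprSr in h *.
by rewrite ler_norml => h1 h2 h3 h4; apply/andP; split; lra.
Qed.

Lemma sin_abs_le x : 0 <= x -> `|sin x| <= x.
Proof.
move=> x0; have := sin_le_id x0; have h1 := sin_geN1 x; have h2 := sin_ge_cubic x0.
rewrite ler_norml => h; apply/andP; split=> //.
case: (lerP x 1) => x1; last by lra.
have : x ^+ 3 <= x by rewrite exprS ler_piMr // exprn_ile1.
by lra.
Qed.

End TrigBounds.

(** * Weights of the recurrence *)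

Section Residual.
Context (R : realType).
Implicit Types n m k : nat.
Local Notation b := (cb R).
Local Notation kap := (kap R).
Local Notation ell := (ell R).
Local Notation fl := (fl R).
Local Notation rt := (rt R).
Local Notation qw := (qw R).

(** The perturbation term of the recurrence [gsol_rec]. *)
Definition vpot n : R := (8 * n%:R + 4)^-1.

Lemma vpot_bounds n : 0 <= vpot n <= (rt n.+1 ^+ 4)^-1.
Proof.
have n0 := ler0n R n; rewrite /vpot invr_ge0 rt4 -natr1; apply/andP; split; first by lra.
by rewrite lef_pV2 ?posrE; lra.
Qed.

Lemma cb2_bounds n : 0 <= b n.+1 ^+ 2 <= (rt n.+1 ^+ 4)^-1.
Proof.
have n0 := ler0n R n; have h := kap_ge R n.+1; have k := kap_le12 R.
have b0 : 0 < b n.+1 ^+ 2 by rewrite exprn_gt0 ?cb_gt0.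
rewrite (ltW b0) /= rt4 -natr1 -[leRHS]mul1r ler_pdivlMr; last by lra.
rewrite -natr1 in h.
have : 0 <= n%:R * b n.+1 ^+ 2 by rewrite mulr_ge0 // ltW.
by lra.
Qed.

Lemma flux_sq_approx (f q Y y c : R) : 1 <= y -> Y = y ^+ 4 -> 2 <= Y -> 0 <= c ->
  kap <= f -> f <= 1 -> f <= kap + c / y ^+ 2 ->
  kap * (Y - 1) <= q -> q <= kap * (Y + 1) ->
  `|f ^+ 2 / q - kap / Y| <= (16 * c + 8) / y ^+ 6.
Proof.
move=> y1 eY Y2 c0 f1 f2 f3 q1 q2.
have K := kap_ge14 R; have K2 := kap_le12 R.
have y20 : 0 < y ^+ 2 by rewrite exprn_gt0; lra.
have q0 : Y / 8 <= q.
  apply: le_trans q1; have : (1 / 4) * (Y - 1) <= kap * (Y - 1) by rewrite ler_wpM2r //; lra.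
  by lra.
have qp : 0 < q by lra.
have -> : f ^+ 2 / q - kap / Y = (f ^+ 2 * Y - kap * q) / (q * Y) by field; lra.
rewrite normrM [`|_^-1|]gtr0_norm ?invr_gt0 ?mulr_gt0 //; last by lra.
rewrite ler_pdivrMr ?mulr_gt0 //; last by lra.
have h1 : `|f ^+ 2 * Y - kap * q| <= 2 * c / y ^+ 2 * Y + 1.
  have a1 : 0 <= (f ^+ 2 - kap ^+ 2) <= 2 * c / y ^+ 2.
    have -> : f ^+ 2 - kap ^+ 2 = (f + kap) * (f - kap) by ring.
    rewrite mulr_ge0 /=; try lra.
    have -> : 2 * c / y ^+ 2 = 2 * (c / y ^+ 2) by ring.
    by apply: ler_pM; lra.
  have a2 : 0 <= (f ^+ 2 - kap ^+ 2) * Y <= 2 * c / y ^+ 2 * Y.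
    by case/andP: a1 => a1 a1'; rewrite mulr_ge0 ?ler_wpM2r //; lra.
  have a3 : kap * (kap * (Y - 1)) <= kap * q <= kap * (kap * (Y + 1)).
    by rewrite !ler_wpM2l //; lra.
  have a4 : kap * kap <= 1 * 1 by apply: ler_pM; lra.
  by case/andP: a2 => ? ?; case/andP: a3 => ? ?; rewrite ler_norml; apply/andP; split; lra.
apply: (le_trans h1).
have y6 : 0 < y ^+ 6 by rewrite exprn_gt0; lra.
have h2 : (16 * c + 8) / y ^+ 6 * (Y / 8 * Y) <= (16 * c + 8) / y ^+ 6 * (q * Y).
  by rewrite ler_wpM2l ?divr_ge0 ?ler_wpM2r //; lra.
apply: le_trans h2.
have -> : (16 * c + 8) / y ^+ 6 * (Y / 8 * Y) = 2 * c * y ^+ 2 + y ^+ 2.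
  by rewrite eY; field; lra.
have -> : 2 * c / y ^+ 2 * Y = 2 * c * y ^+ 2 by rewrite eY; field; lra.
by rewrite lerD2l -[leLHS](expr1n _ 2) lerXn2r // nnegrE; lra.
Qed.

(** The weight b^2 of the recurrence agrees to high order with the mean of the two
  neighbouring values of qw times the squared step of ell: all three are close
  to kappa/(n+2). *)
Lemma weight_approx n :
  `|b n.+1 ^+ 2 - (qw n.+1 * (ell n.+2 - ell n.+1) ^+ 2
                   + qw n * (ell n.+1 - ell n) ^+ 2) / 2| <= 1417 / rt n.+1 ^+ 6.
Proof.
have n0 := ler0n R n; have K := kap_gt0 R.
have qE m : qw m * (ell m.+1 - ell m) ^+ 2 = fl m ^+ 2 / qw m.
  by rewrite /fl; field; rewrite gt_eqF ?qw_gt0.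
rewrite !qE; have y1 := rt_ge1 R n.+1; have eY := rt4 R n.+1.
set y := rt n.+1 in y1 eY *; rewrite -natr1 in eY.
have Y2 : 2 <= n%:R + 1 + 1 :> R by lra.
have y20 : 0 < y ^+ 2 by rewrite exprn_gt0; lra.
have h1 : `|fl n.+1 ^+ 2 / qw n.+1 - kap / (n%:R + 1 + 1)| <= (16 * 88 + 8) / y ^+ 6.
  apply: flux_sq_approx => //; rewrite ?fl_ge ?fl_le1 //.
  - apply: le_trans (fl_upper R n.+1) _; rewrite lerD2l ler_pM2r ?invr_gt0 //; lra.
  - have := qw_ge R n.+1; rewrite -natr1; lra.
  - have := qw_le R n.+1; rewrite -natr1; lra.
have h2 : `|fl n ^+ 2 / qw n - kap / (n%:R + 1 + 1)| <= (16 * 88 + 8) / y ^+ 6.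
  apply: flux_sq_approx => //; rewrite ?fl_ge ?fl_le1 //.
  - apply: le_trans (fl_upper R n) _; rewrite lerD2l.
    have x0 := rt_gt0 R n.
    rewrite ler_pdivrMr ?exprn_gt0 // mulrAC ler_pdivlMr //.
    have : y ^+ 2 <= 2 * rt n ^+ 2.
      have := rt_lt2 R n; rewrite -/y => h.
      have x2 : 0 < 2 * rt n ^+ 2 by rewrite mulr_gt0 ?exprn_gt0.
      have x4 : 0 < rt n ^+ 4 by rewrite exprn_gt0.
      rewrite leNgt; apply/negP => hlt.
      have : (2 * rt n ^+ 2) * (2 * rt n ^+ 2) < y ^+ 2 * y ^+ 2 by apply: ltr_pM; lra.
      by lra.
    by lra.
  - have := qw_ge R n; lra.
  - have := qw_le R n; lra.
have h3 : `|b n.+1 ^+ 2 - kap / (n%:R + 1 + 1)| <= 1 / y ^+ 6.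
  have /andP[B0 B1] := cb2_bounds n.
  rewrite -/y eY in B1; move: (kap_le R n.+1) (kap_ge R n.+1); rewrite -natr1.
  move: (b n.+1 ^+ 2) B0 B1 => B B0 B1 k1 k2.
  have Y0 : 0 < n%:R + 1 + 1 :> R by lra.
  have -> : B - kap / (n%:R + 1 + 1) = (B * (n%:R + 1 + 1) - kap) / (n%:R + 1 + 1).
    by field; lra.
  rewrite normrM [`|_^-1|]gtr0_norm ?invr_gt0 //.
  apply: (@le_trans _ _ ((n%:R + 1 + 1)^-1 * (n%:R + 1 + 1)^-1)).
    apply: ler_wpM2r; first by rewrite invr_ge0 ltW.
    by apply: le_trans B1; rewrite ler_norml; apply/andP; split; lra.
  rewrite -eY -invfM -exprD mul1r lef_pV2 ?posrE ?exprn_gt0; try lra.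
  by rewrite ler_weXn2l.
have : 1 / y ^+ 6 + (16 * 88 + 8) / y ^+ 6 = 1417 / y ^+ 6 by rewrite -mulrDl; congr (_ / _); lra.
move: h1 h2 h3; rewrite !ler_norml => /andP[a1 a2] /andP[b1 b2] /andP[c1 c2] e.
by apply/andP; split; lra.
Qed.

End Residual.

(** * The residual of sin (t ell) / t *)

Section Gronwall.
Context (R : realType).
Implicit Types n m k : nat.
Local Notation b := (cb R).
Local Notation kap := (kap R).
Local Notation ell := (ell R).
Local Notation fl := (fl R).
Local Notation rt := (rt R).
Local Notation qw := (qw R).
Local Notation v := (vpot R).

(** The approximate solution. *)
Definition sn (t : R) n : R := sin (t * ell n) / t.

(** The residual of the approximate solution in the recurrence [gsol_rec]. *)
Definition res (t : R) n : R :=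
  qw n.+1 * (sn t n.+2 - sn t n.+1) - qw n * (sn t n.+1 - sn t n)
  + (t ^+ 2 + v n) * b n.+1 ^+ 2 * sn t n.+1.

Lemma sum3_norm (x y z X Y Z : R) : `|x| <= X -> `|y| <= Y -> `|z| <= Z ->
  `|x + y + z| <= X + Y + Z.
Proof.
move=> hx hy hz; apply: le_trans (ler_normD _ _) _; apply: lerD => //.
by apply: le_trans (ler_normD _ _) _; exact: lerD.
Qed.

Lemma prod_norm (x y X Y : R) : `|x| <= X -> `|y| <= Y -> `|x * y| <= X * Y.
Proof. by move=> hx hy; rewrite normrM ler_pM. Qed.

Lemma step_cubed n (t d : R) : 0 < t <= 1 -> d = ell n.+1 - ell n ->
  qw n * (t * d) ^+ 3 <= 64 * t ^+ 3 / rt n.+1 ^+ 5 /\ 0 <= t * d <= 4.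
Proof.
move=> /andP[t0 t1] ed.
have d0 : 0 < d by rewrite ed; exact: ell_step_gt0.
have d1 : d <= 4 / rt n ^+ 4 by rewrite ed; exact: ell_step_le.
have f1 : qw n * d <= 1 by rewrite ed; exact: fl_le1.
have x1 := rt_ge1 R n; have y1 := rt_ge1 R n.+1; have h := rt_lt2 R n.
move: (rt n) (rt n.+1) x1 y1 h d1 => x y x1 y1 h d1.
have x4 : 0 < x ^+ 4 by rewrite exprn_gt0 //; lra.
have y4 : 0 < y ^+ 4 by rewrite exprn_gt0 //; lra.
have d2 : d <= 8 / y ^+ 4.
  by apply: (le_trans d1); rewrite ler_pdivrMr // mulrAC ler_pdivlMr //; lra.
have x41 : 1 <= x ^+ 4 by exact: exprn_ege1.
have d4 : d <= 4.
  by apply: (le_trans d1); rewrite ler_pdivrMr //; lra.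
split; last first.
  have : t * d <= 1 * 4 by apply: ler_pM; lra.
  have : 0 < t * d by exact: mulr_gt0.
  by move=> h1 h2; apply/andP; split; lra.
have -> : qw n * (t * d) ^+ 3 = t ^+ 3 * ((qw n * d) * (d * d)) by ring.
have -> : 64 * t ^+ 3 / y ^+ 5 = t ^+ 3 * (64 / y ^+ 5) by ring.
rewrite ler_pM2l ?exprn_gt0 //.
have h1 : d * d <= (8 / y ^+ 4) * (8 / y ^+ 4) by apply: ler_pM; lra.
have h2 : qw n * d * (d * d) <= 1 * ((8 / y ^+ 4) * (8 / y ^+ 4)).
  by apply: ler_pM => //; rewrite mulr_ge0 // ltW // qw_gt0.
apply: (le_trans h2).
have -> : 1 * (8 / y ^+ 4 * (8 / y ^+ 4)) = 64 / (y ^+ 8) by field; lra.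
have y0 : 0 < y by lra.
have p5 : 0 < y ^+ 5 by rewrite exprn_gt0.
have p8 : 0 < y ^+ 8 by rewrite exprn_gt0.
rewrite ler_pM2l; last by lra.
by rewrite lef_pV2 // ler_weXn2l.
Qed.

(** A numerical constant for the bound below. *)
Definition resc : R := 300 * 300.

Lemma resc_gt0 : 0 < resc. Proof. by rewrite /resc; lra. Qed.

(** Expanding sine and cosine at a = t ell_(n+1), the terms of first order combine
  with the perturbation term into (sin a - a cos a) / t, which is O(a^3 / t), and
  those of second order are controlled by [weight_approx]. *)
Lemma res_bound n (t : R) : 0 < t <= 1 ->
  `|res t n| <= resc * t ^+ 2 / rt n.+1 ^+ 5.
Proof.
move=> ht; have /andP[t0 t1] := ht.
pose a := t * ell n.+1.
set d := ell n.+2 - ell n.+1; set e := ell n.+1 - ell n.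
have [qd /andP[td0 td4]] := step_cubed ht (erefl d).
have [qe /andP[te0 te4]] := step_cubed ht (erefl e).
have y1 := rt_ge1 R n.+1; have y'1 := le_rtS R n.+1.
set y := rt n.+1 in y1 y'1 qe *; set y' := rt n.+2 in y'1 qd.
have y5 : 0 < y ^+ 5 by rewrite exprn_gt0; lra.
have {}qd : qw n.+1 * (t * d) ^+ 3 <= 64 * t ^+ 3 / y ^+ 5.
  apply: (le_trans qd); rewrite ler_wpM2l //.
    by rewrite mulr_ge0 // exprn_ge0 // ltW.
  by rewrite lef_pV2 ?posrE ?exprn_gt0 ?lerXn2r ?nnegrE; lra.
pose C1 := cos (t * d) - (1 - (t * d) ^+ 2 / 2).
pose S1 := sin (t * d) - t * d.
pose C2 := cos (t * e) - (1 - (t * e) ^+ 2 / 2).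
pose S2 := sin (t * e) - t * e.
have hC1 : `|C1| <= (t * d) ^+ 3 / 6 by apply: cos_sub_quad; rewrite td0.
have hS1 : `|S1| <= (t * d) ^+ 3 / 6 by exact: sin_sub_id.
have hC2 : `|C2| <= (t * e) ^+ 3 / 6 by apply: cos_sub_quad; rewrite te0.
have hS2 : `|S2| <= (t * e) ^+ 3 / 6 by exact: sin_sub_id.
pose E1 := qw n.+1 * (sin a * C1 + cos a * S1).
pose E2 := qw n * (sin a * C2 - cos a * S2).
have eq1 : sn t n.+2 - sn t n.+1 =
    (sin a * (cos (t * d) - 1) + cos a * sin (t * d)) / t.
  rewrite /sn (_ : t * ell n.+2 = a + t * d); last by rewrite /a /d; ring.
  by rewrite sinD -/a; field; lra.
have eq2 : sn t n.+1 - sn t n =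
    (sin a * (1 - cos (t * e)) + cos a * sin (t * e)) / t.
  rewrite /sn (_ : t * ell n = a - t * e); last by rewrite /a /e; ring.
  by rewrite sinB -/a; field; lra.
have eq3 : qw n.+1 * d - qw n * e = - (v n * b n.+1 ^+ 2 * ell n.+1).
  by rewrite -/(fl n.+1) -/(fl n) fl_rec /vpot; ring.
have eR : res t n = v n * b n.+1 ^+ 2 * ((sin a - a * cos a) / t)
    + t * sin a * (b n.+1 ^+ 2 - (qw n.+1 * d ^+ 2 + qw n * e ^+ 2) / 2)
    + (E1 + E2) / t.
  rewrite /res eq1 eq2 /sn -/a /E1 /E2.
  have c1 : cos (t * d) = C1 + (1 - (t * d) ^+ 2 / 2) by rewrite /C1 subrK.
  have c2 : cos (t * e) = C2 + (1 - (t * e) ^+ 2 / 2) by rewrite /C2 subrK.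
  have s1 : sin (t * d) = S1 + t * d by rewrite /S1 subrK.
  have s2 : sin (t * e) = S2 + t * e by rewrite /S2 subrK.
  rewrite c1 c2 s1 s2.
  have -> : v n * b n.+1 ^+ 2 * ((sin a - a * cos a) / t) =
     v n * b n.+1 ^+ 2 * sin a / t + cos a * (qw n.+1 * d - qw n * e).
    by rewrite eq3 /a; field; lra.
  by field; lra.
have b1 : `|v n * b n.+1 ^+ 2 * ((sin a - a * cos a) / t)| <= (21 * 21 * 21) * t ^+ 2 / y ^+ 5.
  have a0 : 0 <= a by rewrite mulr_ge0 ?ltW ?ell_gt0.
  have ha : a <= t * (21 * y) by rewrite ler_pM2l // ell_rt.
  have ha3 : a ^+ 3 <= (t * (21 * y)) ^+ 3 by rewrite lerXn2r // nnegrE; lra.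
  have /andP[v0 v1] := vpot_bounds R n; have /andP[B0 B1] := cb2_bounds R n.
  have h1 : `|(sin a - a * cos a) / t| <= (t * (21 * y)) ^+ 3 / t.
    rewrite normrM [`|_^-1|]gtr0_norm ?invr_gt0 // ler_pM2r ?invr_gt0 //.
    by apply: le_trans ha3; exact: sin_sub_xcos.
  have h2 : `|v n * b n.+1 ^+ 2| <= (y ^+ 4)^-1 * (y ^+ 4)^-1.
    by apply: prod_norm; rewrite ger0_norm.
  apply: le_trans (prod_norm h2 h1) _.
  rewrite le_eqVlt; apply/orP; left; apply/eqP.
  clearbody y; clear -t0 y1; field.
  by apply/andP; split; lra.
have b2 : `|t * sin a * (b n.+1 ^+ 2 - (qw n.+1 * d ^+ 2 + qw n * e ^+ 2) / 2)|
    <= (21 * 1417) * t ^+ 2 / y ^+ 5.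
  have a0 : 0 <= a by rewrite mulr_ge0 ?ltW ?ell_gt0.
  have ha : a <= t * (21 * y) by rewrite ler_pM2l // ell_rt.
  have h1 : `|t * sin a| <= t * (t * (21 * y)).
    apply: prod_norm; first by rewrite gtr0_norm.
    by apply: le_trans ha; exact: sin_abs_le.
  apply: le_trans (prod_norm h1 (weight_approx R n)) _.
  by rewrite le_eqVlt; apply/orP; left; apply/eqP; rewrite -/y; field; lra.
have sa : `|sin a| <= 1 by exact: sin_max.
have ca : `|cos a| <= 1 by exact: cos_max.
have b3 : `|(E1 + E2) / t| <= 43 * t ^+ 2 / y ^+ 5.
  have q1 := qw_gt0 R n.+1; have q0 := qw_gt0 R n.
  have e1 : `|E1| <= 64 * t ^+ 3 / y ^+ 5 / 3.
    rewrite /E1 normrM gtr0_norm //.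
    apply: (@le_trans _ _ (qw n.+1 * ((t * d) ^+ 3 / 3))); last by clear -qd; lra.
    rewrite ler_pM2l //; apply: le_trans (ler_normD _ _) _.
    by have := prod_norm sa hC1; have := prod_norm ca hS1; clear; lra.
  have e2 : `|E2| <= 64 * t ^+ 3 / y ^+ 5 / 3.
    rewrite /E2 normrM gtr0_norm //.
    apply: (@le_trans _ _ (qw n * ((t * e) ^+ 3 / 3))); last by clear -qe; lra.
    rewrite ler_pM2l //; apply: le_trans (ler_normB _ _) _.
    by have := prod_norm sa hC2; have := prod_norm ca hS2; clear; lra.
  rewrite normrM [`|_^-1|]gtr0_norm ?invr_gt0 // ler_pdivrMr //.
  apply: le_trans (ler_normD _ _) _.
  have -> : 43 * t ^+ 2 / y ^+ 5 * t = 43 * (t ^+ 3 / y ^+ 5) by ring.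
  have : 0 <= t ^+ 3 / y ^+ 5 by rewrite divr_ge0 ?(ltW y5) // exprn_ge0 // ltW.
  by clear -e1 e2; lra.
rewrite eR; apply: le_trans (sum3_norm b1 b2 b3) _; rewrite /resc.
have : 0 <= t ^+ 2 / y ^+ 5 by rewrite divr_ge0 ?(ltW y5) // sqr_ge0.
by clear; lra.
Qed.

End Gronwall.

(** * Discrete Gronwall estimate *)

Section GronwallMain.
Context (R : realType).
Implicit Types n m k : nat.
Local Notation b := (cb R).
Local Notation H := (harm R).
Local Notation kap := (kap R).
Local Notation ell := (ell R).
Local Notation rt := (rt R).
Local Notation qw := (qw R).
Local Notation v := (vpot R).

(** The error of the approximation of the solution by sin (t ell) / t. *)
Definition err (t : R) n : R := gsol n (1 / 4 + t ^+ 2) / kap - sn t n.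

(** The flux of the error. *)
Definition ferr (t : R) n : R := qw n * (err t n.+1 - err t n).

Lemma ferr_rec t n :
  ferr t n.+1 = ferr t n - (t ^+ 2 + v n) * b n.+1 ^+ 2 * err t n.+1 - res t n.
Proof.
have := gsol_rec n (1 / 4 + t ^+ 2); rewrite -/(v n) => e.
have K := kap_gt0 R.
rewrite /ferr /err /res.
move: (gsol n.+2 _) (gsol n.+1 _) (gsol n _) e => g2 g1 g0 e.
apply/eqP; rewrite -subr_eq0; apply/eqP.
transitivity ((qw n.+1 * (g2 - g1) - qw n * (g1 - g0)
  + (t ^+ 2 + v n) * b n.+1 ^+ 2 * g1) / kap); first by field; rewrite gt_eqF.
by rewrite e; field; rewrite gt_eqF.
Qed.

Lemma ell1 : ell 1 = 3 / 2 * ell 0.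
Proof.
have := fl0 R; rewrite /fl /qw cb0 cb1 => h.
by lra.
Qed.

Lemma ell0_le4 : ell 0 <= 4.
Proof.
rewrite ell0 -[_^-1]mul1r ler_pdivrMr ?kap_gt0 //.
by have := kap_ge14 R; lra.
Qed.

Lemma sn_sub (t l c : R) : 0 < t -> 0 <= l <= c ->
  `|l - sin (t * l) / t| <= t ^+ 2 * (c ^+ 3 / 6).
Proof.
move=> t0 /andP[l0 lc].
have tl : 0 <= t * l by rewrite mulr_ge0 // ltW.
have -> : l - sin (t * l) / t = - ((sin (t * l) - t * l) / t) by field; lra.
rewrite normrN normrM [`|_^-1|]gtr0_norm ?invr_gt0 // ler_pdivrMr //.
apply: le_trans (sin_sub_id tl) _.
have -> : (t * l) ^+ 3 / 6 = t ^+ 3 * (l ^+ 3 / 6) by ring.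
have -> : t ^+ 2 * (c ^+ 3 / 6) * t = t ^+ 3 * (c ^+ 3 / 6) by ring.
rewrite ler_pM2l ?exprn_gt0 // ler_pM2r //.
by rewrite lerXn2r // nnegrE; lra.
Qed.

Lemma err_init (t : R) : 0 < t <= 1 ->
  `|err t 0| <= 11 * t ^+ 2 /\ `|ferr t 0| <= 28 * t ^+ 2.
Proof.
move=> /andP[t0 t1]; have l0 := ell_gt0 R 0; have l4 := ell0_le4.
have t2 : 0 < t ^+ 2 by rewrite exprn_gt0.
have e0 : `|err t 0| <= t ^+ 2 * (4 ^+ 3 / 6).
  rewrite /err gsol0 mul1r -ell0; apply: sn_sub => //.
  by apply/andP; split; lra.
have e1 : `|err t 1 + 2 * t ^+ 2 / kap| <= t ^+ 2 * (6 ^+ 3 / 6).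
  have -> : err t 1 + 2 * t ^+ 2 / kap = ell 1 - sin (t * ell 1) / t.
    rewrite /err gsol1 /sn ell1 ell0; set s := sin _ / t.
    by field; rewrite gt_eqF ?kap_gt0.
  by apply: sn_sub => //; rewrite ell1; apply/andP; split; lra.
have e2 : 0 <= 2 * t ^+ 2 / kap <= 8 * t ^+ 2.
  rewrite -ell0; have -> : 2 * t ^+ 2 * ell 0 = t ^+ 2 * (2 * ell 0) by ring.
  rewrite mulr_ge0 /=; try lra.
  by rewrite [8 * _]mulrC ler_pM2l; lra.
rewrite /ferr /qw cb0 cb1.
move: e0 e1 e2; rewrite !ler_norml => /andP[a1 a2] /andP[b1 b2] /andP[c1 c2].
by split; apply/andP; split; lra.
Qed.

Lemma rt5_step n : (rt n.+1 ^+ 5)^-1 <= 4 * ((rt n)^-1 - (rt n.+1)^-1).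
Proof.
have := rt_step R n; have := le_rtS R n; have := rt_gt0 R n.
move: (rt n) (rt n.+1) => x y x0 xy h.
have y0 : 0 < y by lra.
have -> : x^-1 - y^-1 = (y - x) / (x * y) by field; rewrite !gt_eqF.
rewrite -[leLHS]mul1r ler_pdivrMr ?exprn_gt0 //.
have -> : 4 * ((y - x) / (x * y)) * y ^+ 5 = 4 * y ^+ 3 * (y - x) * (y / x).
  by field; rewrite !gt_eqF.
apply: (le_trans h); apply: ler_peMr.
  by rewrite mulr_ge0 ?mulr_ge0 ?exprn_ge0 //; lra.
by rewrite ler_pdivlMr // mul1r.
Qed.

(** The logarithmic weight for err. *)
Definition wt n : R := H n + 1.

(** A bound for the initial flux and the partial sums of the residuals, both divided
  by t^2; see [err_init] and [rt5_step]. *)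
Definition maj_res n : R := 28 + 4 * resc R * (1 - (rt n)^-1).

(** The exponent of the Gronwall factor; see [pot_step]. *)
Definition maj_exp (t : R) n : R :=
  4 * t ^+ 2 * wt n * H n + 200 * (1 - (rt n)^-1).

(** The sequence that majorizes ferr. *)
Definition maj (t : R) n : R := t ^+ 2 * maj_res n * expR (maj_exp t n).

Lemma wt_ge1 n : 1 <= wt n.
Proof. by rewrite /wt lerDr harm_ge0. Qed.

Lemma wt_gt0 n : 0 < wt n.
Proof. by apply: lt_le_trans (wt_ge1 n). Qed.

Lemma rt_compl_bounds n : 0 <= 1 - (rt n)^-1 <= 1.
Proof.
have h := rt_ge1 R n; have h0 := rt_gt0 R n.
have : 0 < (rt n)^-1 by rewrite invr_gt0.
have : (rt n)^-1 <= 1 by rewrite invf_le1.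
by move=> ? ?; apply/andP; split; lra.
Qed.

Lemma maj_res_bounds n : 28 <= maj_res n <= 28 + 4 * resc R.
Proof.
have C0 := resc_gt0 R; case/andP: (rt_compl_bounds n) => a1 a2.
rewrite /maj_res lerDl lerD2l; apply/andP; split.
  by apply: mulr_ge0 => //; rewrite mulr_ge0 // ltW.
by rewrite ler_piMr // mulr_ge0 // ltW.
Qed.

Lemma maj_res_gt0 n : 0 < maj_res n.
Proof. by have /andP[h _] := maj_res_bounds n; apply: lt_le_trans h; lra. Qed.

Lemma maj_exp_ge0 t n : 0 <= maj_exp t n.
Proof.
case/andP: (rt_compl_bounds n) => a1 _.
apply: addr_ge0; last by apply: mulr_ge0 a1; exact: ler0n.
apply: mulr_ge0; last exact: harm_ge0.
by apply: mulr_ge0; [rewrite mulr_ge0 ?sqr_ge0 | exact/ltW/wt_gt0].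
Qed.

Lemma maj_gt0 t n : 0 < t -> 0 < maj t n.
Proof.
move=> t0; rewrite /maj pmulr_lgt0 ?expR_gt0 //.
by rewrite pmulr_lgt0 ?maj_res_gt0 // exprn_gt0.
Qed.

(** The coefficient of the recurrence for the flux; see [ferr_rec]. *)
Definition pot (t : R) n : R := (t ^+ 2 + v n) * b n.+1 ^+ 2.

Lemma pot_ge0 t n : 0 <= pot t n.
Proof.
have /andP[v0 _] := vpot_bounds R n; have /andP[B0 _] := cb2_bounds R n.
by apply: mulr_ge0 => //; apply: addr_ge0 => //; exact: sqr_ge0.
Qed.

Lemma pot_small n : v n * b n.+1 ^+ 2 * wt n.+1 <= 9 / rt n.+1 ^+ 5.
Proof.
have /andP[v0 v1] := vpot_bounds R n; have /andP[B0 B1] := cb2_bounds R n.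
have y1 := rt_ge1 R n.+1; have hr := harm_rt R n.+1; have w0 := ltW (wt_gt0 n.+1).
have hw : wt n.+1 <= 9 * rt n.+1 by rewrite /wt; lra.
move: (rt n.+1) y1 v1 B1 hw {hr} => y y1 v1 B1 hw.
have y0 : 0 < y by apply: lt_le_trans y1.
have y4 : 0 < (y ^+ 4)^-1 by rewrite invr_gt0 exprn_gt0.
apply: (@le_trans _ _ ((y ^+ 4)^-1 * (y ^+ 4)^-1 * (9 * y))).
  by apply: ler_pM => //; [exact: mulr_ge0 | exact: ler_pM].
have -> : (y ^+ 4)^-1 * (y ^+ 4)^-1 * (9 * y) = 9 / y ^+ 5 / y ^+ 2.
  by field; rewrite gt_eqF.
rewrite ler_pdivrMr ?exprn_gt0 //; apply: ler_peMr.
  by rewrite divr_ge0 // exprn_ge0 // ltW.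
exact: exprn_ege1.
Qed.

Lemma pot_step t n : 0 < t ->
  4 * pot t n * wt n.+1 <= maj_exp t n.+1 - maj_exp t n.
Proof.
move=> t0; have t2 : 0 < t ^+ 2 by rewrite exprn_gt0.
have /andP[B0 B1] := cb2_bounds R n; have w0 := wt_gt0 n.+1.
have n0 := ler0n R n; have h0 := harm_ge0 R n.
pose del : R := (n%:R + 1)^-1.
have del0 : 0 < del by rewrite invr_gt0; lra.
have Bd : b n.+1 ^+ 2 <= del.
  apply: (le_trans B1); rewrite rt4 /del -natr1.
  by rewrite lef_pV2 ?posrE; clear -n0; lra.
have p1 : t ^+ 2 * b n.+1 ^+ 2 * wt n.+1 <=
    t ^+ 2 * (wt n.+1 * H n.+1 - wt n * H n).
  rewrite -mulrA ler_pM2l //.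
  have -> : wt n.+1 * H n.+1 - wt n * H n = del * wt n.+1 + del * H n.
    by rewrite /wt harmS -/del; ring.
  apply: ler_wpDr; first by rewrite mulr_ge0 // ltW.
  by rewrite ler_pM2r.
have p2 := pot_small n; have y5 := rt5_step n.
have -> : 4 * pot t n * wt n.+1 = 4 * (t ^+ 2 * b n.+1 ^+ 2 * wt n.+1)
    + 4 * (v n * b n.+1 ^+ 2 * wt n.+1) by rewrite /pot; ring.
have y50 : 0 < (rt n.+1 ^+ 5)^-1 by rewrite invr_gt0 exprn_gt0 ?rt_gt0.
rewrite /maj_exp; clear -p1 p2 y5 y50; lra.
Qed.

Lemma maj_step t n : 0 < t ->
  maj t n * (1 + 4 * pot t n * wt n.+1) + resc R * t ^+ 2 / rt n.+1 ^+ 5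
    <= maj t n.+1.
Proof.
move=> t0; have t2 : 0 < t ^+ 2 by rewrite exprn_gt0.
have cS := pot_step n t0; have C0 := resc_gt0 R; have A0 := maj_res_gt0 n.
have ex : expR (maj_exp t n) * (1 + 4 * pot t n * wt n.+1) <= expR (maj_exp t n.+1).
  have -> : maj_exp t n.+1 = maj_exp t n + (maj_exp t n.+1 - maj_exp t n) by ring.
  rewrite expRD ler_pM2l ?expR_gt0 //.
  by apply: le_trans (expR_ge1Dx _); rewrite lerD2l.
have ex1 : 1 <= expR (maj_exp t n.+1) by rewrite -expR0 ler_expR maj_exp_ge0.
have y50 : 0 < (rt n.+1 ^+ 5)^-1 by rewrite invr_gt0 exprn_gt0 ?rt_gt0.
have AS : maj_res n + resc R * (rt n.+1 ^+ 5)^-1 <= maj_res n.+1.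
  have : resc R * (rt n.+1 ^+ 5)^-1 <= resc R * (4 * ((rt n)^-1 - (rt n.+1)^-1)).
    by rewrite ler_pM2l // rt5_step.
  by rewrite /maj_res; clear; lra.
apply: (@le_trans _ _ (t ^+ 2 * (maj_res n + resc R * (rt n.+1 ^+ 5)^-1)
    * expR (maj_exp t n.+1))); last first.
  by rewrite /maj ler_pM2r ?expR_gt0 // ler_pM2l.
have -> : t ^+ 2 * (maj_res n + resc R * (rt n.+1 ^+ 5)^-1) * expR (maj_exp t n.+1)
  = t ^+ 2 * maj_res n * expR (maj_exp t n.+1)
    + t ^+ 2 * (resc R * (rt n.+1 ^+ 5)^-1) * expR (maj_exp t n.+1) by ring.
apply: lerD.
  by rewrite /maj -mulrA ler_pM2l // mulr_gt0.
have -> : resc R * t ^+ 2 / rt n.+1 ^+ 5 = t ^+ 2 * (resc R * (rt n.+1 ^+ 5)^-1).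
  by ring.
apply: (ler_peMr _ ex1); apply: mulr_ge0; first exact: ltW.
by apply: mulr_ge0; exact: ltW.
Qed.

Lemma maj_mono t n : 0 < t -> maj t n <= maj t n.+1.
Proof.
move=> t0; apply: le_trans (maj_step n t0); rewrite mulrDr mulr1 -addrA lerDl.
have y50 : 0 < (rt n.+1 ^+ 5)^-1 by rewrite invr_gt0 exprn_gt0 ?rt_gt0.
apply: addr_ge0; last first.
  by apply: mulr_ge0; [rewrite mulr_ge0 ?sqr_ge0 // ltW ?resc_gt0 | exact: ltW].
apply: mulr_ge0; first exact/ltW/maj_gt0.
by apply: mulr_ge0; [rewrite mulr_ge0 ?pot_ge0 | exact/ltW/wt_gt0].
Qed.

Lemma err_maj (t : R) n : 0 < t <= 1 ->
  `|ferr t n| <= maj t n /\ `|err t n| <= 4 * maj t n * wt n.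
Proof.
move=> ht; have /andP[t0 t1] := ht; have t2 : 0 < t ^+ 2 by rewrite exprn_gt0.
elim: n => [|n [IH1 IH2]].
  have [h1 h2] := err_init ht.
  have -> : maj t 0 = 28 * t ^+ 2.
    rewrite /maj /maj_res /maj_exp /wt /harm big_ord0 mulr0.
    have -> : rt 0 = 1 by rewrite /rt add0r !sqrtr1.
    by rewrite invr1 subrr !mulr0 !addr0 expR0; ring.
  by split=> //; rewrite /wt /harm big_ord0; lra.
have z0 := maj_gt0 n t0; have q0 := qw_gt0 R n.
have w0 := wt_gt0 n.+1.
have e1 : `|err t n.+1| <= 4 * maj t n * wt n.+1.
  have -> : err t n.+1 = err t n + ferr t n / qw n.
    by rewrite /ferr; field; rewrite gt_eqF.
  have -> : wt n.+1 = wt n + (n%:R + 1)^-1 by rewrite /wt harmS; ring.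
  apply: le_trans (ler_normD _ _) _; rewrite mulrDr; apply: lerD => //.
  rewrite normrM [`|_^-1|]gtr0_norm ?invr_gt0 //.
  have -> : 4 * maj t n * (n%:R + 1)^-1 = maj t n * (4 * (n%:R + 1)^-1) by ring.
  apply: ler_pM => //; first by rewrite invr_ge0 ltW.
  rewrite -[_^-1]mul1r ler_pdivrMr //.
  have -> : 4 * (n%:R + 1)^-1 * qw n = 4 * qw n / (n%:R + 1) by ring.
  have n0 := ler0n R n; have n1 : 0 < n%:R + 1 :> R by lra.
  rewrite ler_pdivlMr // mul1r; have qg := qw_ge R n.
  have : 1 / 4 * (n%:R + 1) <= kap * (n%:R + 1) by rewrite ler_pM2r ?kap_ge14.
  by clear -qg; lra.
split; last first.
  apply: (le_trans e1); apply: ler_wpM2r; first exact: ltW.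
  by apply: ler_wpM2l; [exact: ler0n | exact: maj_mono].
apply: le_trans (maj_step n t0).
rewrite ferr_rec -/(pot t n) [maj t n * (1 + _)]mulrDr mulr1.
apply: le_trans (ler_normB _ _) _; apply: lerD; last exact: res_bound.
apply: le_trans (ler_normB _ _) _; apply: lerD => //.
rewrite normrM (ger0_norm (pot_ge0 t n)).
have -> : maj t n * (4 * pot t n * wt n.+1) = pot t n * (4 * maj t n * wt n.+1).
  by ring.
by apply: ler_wpM2l => //; exact: pot_ge0.
Qed.

Lemma err_bound (T : R) : exists2 M, 0 < M & forall (t : R) n, 0 < t <= 1 ->
  t * (H n + 1) <= T ->
  `|ferr t n| <= M * t ^+ 2 /\ `|err t n| <= M * t ^+ 2 * (H n + 1).
Proof.
pose K : R := 28 + 4 * resc R; pose X := expR (4 * T ^+ 2 + 200).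
have K0 : 0 < K by apply: addr_gt0 => //; rewrite mulr_gt0 ?resc_gt0.
have X0 : 0 < X by exact: expR_gt0.
exists (4 * (K * X)); first by rewrite mulr_gt0 // mulr_gt0.
move=> t n ht hT; have [k1 k2] := err_maj n ht; have /andP[t0 t1] := ht.
have t2 : 0 < t ^+ 2 by rewrite exprn_gt0.
have z0 := maj_gt0 n t0; have w0 := wt_gt0 n.
have zM : maj t n <= K * X * t ^+ 2.
  have -> : K * X * t ^+ 2 = t ^+ 2 * (K * X) by ring.
  rewrite /maj -mulrA ler_pM2l //; have /andP[_ A1] := maj_res_bounds n.
  apply: ler_pM; [exact/ltW/maj_res_gt0 | exact: expR_ge0 | exact: A1 |].
  have /andP[_ r1] := rt_compl_bounds n.
  rewrite ler_expR /maj_exp; apply: lerD; last by clear -r1; lra.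
  have -> : 4 * t ^+ 2 * wt n * H n = 4 * (t * wt n * (t * H n)) by ring.
  rewrite ler_pM2l // expr2; apply: ler_pM => //.
  - by rewrite mulr_ge0 // ltW.
  - by rewrite mulr_ge0 ?harm_ge0 // ltW.
  - by apply: le_trans hT; rewrite ler_pM2l // lerDl.
split.
  apply: (le_trans k1); apply: (le_trans zM); rewrite ler_pM2r //.
  by rewrite ler_peMl ?mulr_ge0 ?ltW // ltr1n.
apply: (le_trans k2); rewrite -/(wt n) ler_pM2r //.
by rewrite -[_ * (K * X) * _]mulrA ler_pM2l.
Qed.

End GronwallMain.

(** * Sine and cosine approximations *)

Section SineApproximation.
Context (R : realType).
Implicit Types n m k : nat.
Local Notation H := (harm R).
Local Notation kap := (kap R).
Local Notation ell := (ell R).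
Local Notation fl := (fl R).
Local Notation qw := (qw R).

(** The spectral parameter for which t ell_n = x. *)
Definition lam n (x : R) : R := 1 / 4 + (x / ell n) ^+ 2.

Lemma scale_bounds (X x : R) n : 14 <= ell n -> X <= ell n -> 0 < x <= X ->
  0 < x / ell n <= 1 /\ x / ell n * (H n + 1) <= 2 * X.
Proof.
move=> l14 lX /andP[x0 xX]; have l0 : 0 < ell n by lra.
have h1 : 0 < x / ell n <= 1.
  by rewrite divr_gt0 //= ler_pdivrMr //; lra.
split=> //; have hw : H n + 1 <= 2 * ell n.
  by have := ell_sub_harm R n; rewrite ler_norml => /andP[a1 a2]; lra.
apply: (@le_trans _ _ (x / ell n * (2 * ell n))).
  by case/andP: h1 => h1 _; rewrite ler_pM2l.
have -> : x / ell n * (2 * ell n) = 2 * x by field; lra.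
by lra.
Qed.

Lemma W_sin (X : R) : exists2 M, 0 < M & forall n x, 14 <= ell n -> X <= ell n ->
  0 < x <= X ->
  `|x / ell n * (gsol n (lam n x) / kap) - sin x| <= M * x ^+ 3 / ell n ^+ 2.
Proof.
have [M M0 hM] := err_bound (2 * X); exists (2 * M); first by lra.
move=> n x l14 lX hx; have [ht hT] := scale_bounds l14 lX hx.
have [_ e] := hM _ _ ht hT; have l0 : 0 < ell n by lra.
have /andP[x0 _] := hx; have /andP[t0 _] := ht.
have -> : x / ell n * (gsol n (lam n x) / kap) - sin x = x / ell n * err (x / ell n) n.
  rewrite /err /sn /lam mulfVK ?gt_eqF // mulrBr; congr (_ - _).
  by field; rewrite !gt_eqF.
rewrite normrM gtr0_norm //; apply: (@le_trans _ _ (x / ell n * (M * (x / ell n) ^+ 2 * (2 * ell n)))).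
  rewrite ler_pM2l //; apply: (le_trans e); apply: ler_wpM2l.
    by apply: mulr_ge0; [exact: ltW | exact: sqr_ge0].
  by have := ell_sub_harm R n; rewrite ler_norml => /andP[a1 a2]; lra.
by rewrite le_eqVlt; apply/orP; left; apply/eqP; field; lra.
Qed.

Lemma flux_cos (X : R) : exists2 M, 0 < M & forall m x, 14 <= ell m.+1 -> X <= ell m.+1 ->
  0 < x <= X ->
  `|qw m * (gsol m.+1 (lam m.+1 x) - gsol m (lam m.+1 x)) / kap - fl m * cos x|
    <= M * x / ell m.+1.
Proof.
have [M M0 hM] := err_bound (2 * X); exists (5 + M); first by lra.
move=> m x l14 lX hx; have [ht hT] := scale_bounds l14 lX hx.
have l0 : 0 < ell m.+1 by lra.
have /andP[x0 _] := hx; have /andP[t0 t1] := ht.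
have hT' : x / ell m.+1 * (H m + 1) <= 2 * X.
  by apply: le_trans hT; rewrite ler_pM2l // lerD2r le_harm.
have [e _] := hM _ _ ht hT'.
have ex : x = x / ell m.+1 * ell m.+1 by rewrite mulfVK ?gt_eqF.
have -> : (5 + M) * x / ell m.+1 = (5 + M) * (x / ell m.+1) by ring.
rewrite /lam; set t := x / ell m.+1 in ht hT hT' e t0 t1 ex *.
set d := ell m.+1 - ell m.
have [_ /andP[td0 td4]] := step_cubed ht (erefl d).
have d0 : 0 < d by exact: ell_step_gt0.
have q0 := qw_gt0 R m; have f1 := fl_le1 R m.
have fE : fl m = qw m * d by [].
have d4 : d <= 4.
  apply: (le_trans (ell_step_le R m)); rewrite ler_pdivrMr ?exprn_gt0 ?rt_gt0 //.
  have : 1 <= rt R m ^+ 4 by rewrite exprn_ege1 // rt_ge1.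
  by lra.
have sE : sn t m.+1 - sn t m = (sin x * (1 - cos (t * d)) + cos x * sin (t * d)) / t.
  rewrite /sn (_ : t * ell m = x - t * d) -?ex; last by rewrite [in RHS]ex /d; ring.
  by rewrite sinB; field; lra.
have -> : qw m * (gsol m.+1 (1 / 4 + t ^+ 2) - gsol m (1 / 4 + t ^+ 2)) / kap - fl m * cos x =
   ferr t m + (qw m * (sin x * (1 - cos (t * d))) / t
     + qw m * (cos x * (sin (t * d) - t * d)) / t).
  rewrite /ferr /err.
  have -> : gsol m.+1 (1 / 4 + t ^+ 2) / kap - sn t m.+1 - (gsol m (1 / 4 + t ^+ 2) / kap - sn t m)
    = (gsol m.+1 (1 / 4 + t ^+ 2) - gsol m (1 / 4 + t ^+ 2)) / kap - (sn t m.+1 - sn t m) by ring.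
  by rewrite sE fE; field; rewrite !gt_eqF // kap_gt0.
have sx : `|sin x| <= 1 by exact: sin_max.
have cx : `|cos x| <= 1 by exact: cos_max.
have hc : `|1 - cos (t * d)| <= (t * d) ^+ 2 / 2.
  have := cos_ge_quad td0; have := cos_le1 (t * d).
  by have := sqr_ge0 (t * d); rewrite ler_norml => ? ? ?; apply/andP; split; lra.
have hs := sin_sub_id td0.
have tt : 0 < t * t by exact: mulr_gt0.
have qd2 : qw m * (t * d) ^+ 2 <= 4 * t * t.
  have -> : qw m * (t * d) ^+ 2 = (qw m * d) * d * (t * t) by ring.
  have -> : 4 * t * t = 4 * (t * t) by ring.
  rewrite ler_pM2r //.
  have : qw m * d * d <= 1 * 4 by apply: ler_pM => //; [apply: mulr_ge0; exact: ltW | exact: ltW].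
  by lra.
have qd3 : qw m * (t * d) ^+ 3 <= 16 * t * t.
  have -> : qw m * (t * d) ^+ 3 = qw m * (t * d) ^+ 2 * (t * d) by ring.
  have : qw m * (t * d) ^+ 2 * (t * d) <= 4 * t * t * 4.
    apply: ler_pM; [by apply: mulr_ge0; [exact: ltW | exact: sqr_ge0] | exact: td0 | exact: qd2 | exact: td4].
  by lra.
have b1 : `|qw m * (sin x * (1 - cos (t * d))) / t| <= 2 * t.
  rewrite normrM [`|_^-1|]gtr0_norm ?invr_gt0 // ler_pdivrMr //.
  rewrite normrM gtr0_norm //; apply: (@le_trans _ _ (qw m * (1 * ((t * d) ^+ 2 / 2)))).
    by rewrite ler_pM2l //; exact: prod_norm.
  by lra.
have b2 : `|qw m * (cos x * (sin (t * d) - t * d)) / t| <= 3 * t.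
  rewrite normrM [`|_^-1|]gtr0_norm ?invr_gt0 // ler_pdivrMr //.
  rewrite normrM gtr0_norm //; apply: (@le_trans _ _ (qw m * (1 * ((t * d) ^+ 3 / 6)))).
    by rewrite ler_pM2l //; exact: prod_norm.
  by lra.
rewrite addrA; apply: le_trans (sum3_norm e b1 b2) _.
have : M * t ^+ 2 <= M * t by rewrite ler_pM2l // expr2 ler_piMr // ltW.
by lra.
Qed.

(** The sine is at least one third between the windows around its zeros. *)
Lemma sin_gap (y : R) : 1 <= y <= pi - 1 -> 1 / 3 <= sin y.
Proof.
have aux (z : R) : 1 <= z <= 2 -> 1 / 3 <= sin z.
  move=> /andP[z1 z2]; have z0 : 0 <= z by lra.
  apply: le_trans (sin_ge_cubic z0).
  have : z ^+ 2 <= 2 ^+ 2 by rewrite lerXn2r // nnegrE; lra.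
  move=> h; have : z * z ^+ 2 <= z * 2 ^+ 2 by rewrite ler_wpM2l.
  by rewrite -exprS; lra.
move=> /andP[y1 y2]; case: (lerP y 2) => y3; first by apply: aux; rewrite y1.
have <- : sin (pi - y) = sin y by rewrite sinB sinpi cospi; ring.
by apply: aux; have := pihalf_lt2 R => h; apply/andP; split; lra.
Qed.

Lemma sin_window (y : R) : `|y| <= 1 -> 5 / 6 * `|y| <= `|sin y|.
Proof.
have aux (z : R) : 0 <= z <= 1 -> 5 / 6 * z <= sin z.
  move=> /andP[z0 z1]; apply: le_trans (sin_ge_cubic z0).
  have : z ^+ 3 <= z by rewrite exprS ler_piMr // exprn_ile1.
  by lra.
move=> y1; have y0 := normr_ge0 y.
have <- : `|sin `|y| | = `|sin y|.
  case: (lerP 0 y) => h; first by rewrite [`|y|]ger0_norm.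
  by rewrite [`|y|]ltr0_norm // sinN normrN.
have h : 0 <= `|y| <= 1 by rewrite y0.
by apply: le_trans (aux _ h) _; exact: ler_norm.
Qed.

Lemma cos_window (y : R) : `|y| <= 1 -> 1 / 2 <= cos y.
Proof.
move=> y1; have y0 := normr_ge0 y; rewrite -cos_norm.
apply: le_trans (cos_ge_quad y0).
have : `|y| ^+ 2 <= 1 by rewrite exprn_ile1.
by lra.
Qed.

Lemma sin_pi_shift (y : R) k : sin (pi * k%:R + y) = (-1) ^+ k * sin y.
Proof.
by rewrite addrC mulr_natr (alternatingn (@sinDpi R)).
Qed.

Lemma cos_pi_shift (y : R) k : cos (pi * k%:R + y) = (-1) ^+ k * cos y.
Proof.
by rewrite addrC mulr_natr (alternatingn (@cosDpi R)).
Qed.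

End SineApproximation.

(** * Zeros of W_n and eigenvalues *)

Section Spectrum.
Context (R : realType).
Implicit Types n m k : nat.

Lemma poly_ext (p q : {poly R}) : (forall x, p.[x] = q.[x]) -> p = q.
Proof.
move=> h; apply/eqP; rewrite -subr_eq0; apply/negPn/negP => d0.
pose rs := [seq i%:R : R | i <- iota 0 (size (p - q))].
have := max_poly_roots d0 (rs := rs).
have -> : all (root (p - q)) rs.
  by apply/allP => x _; rewrite rootE !hornerE h subrr.
have -> : uniq rs.
  by rewrite map_inj_uniq ?iota_uniq // => i j /eqP; rewrite eqr_nat => /eqP.
by rewrite size_map size_iota ltnn => /(_ isT isT).
Qed.

Lemma horner_char_poly n (A : 'M[R]_n) y : (char_poly A).[y] = \det (y%:M - A).
Proof.
rewrite /char_poly -horner_evalE -det_map_mx; congr (\det _).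
by apply/matrixP => i j; rewrite !mxE /= horner_evalE !hornerE; case: (i == j);
   rewrite ?mulr1n ?mulr0n !hornerE.
Qed.

Lemma W_prod n :
  W R n = \prod_(x <- eigenvalues (Lmx R n)) (1 - x *: 'X).
Proof.
set E := eigenvalues _; apply: poly_ext => x; rewrite horner_prod.
have sE : size E = n by apply: size_eigenvalues; exact: tr_Lmx.
have hP : \prod_(i <- E) (1 - i *: 'X).[x] = \prod_(i <- E) (1 - i * x).
  by apply: eq_bigr => i _; rewrite -polyC1 !(hornerD, hornerN, hornerC, hornerZ, hornerX).
rewrite hP -det_Lmx; have [->|x0] := eqVneq x 0.
  rewrite scale0r subr0 det1 big1_seq // => i _.
  by rewrite mulr0 subr0.
have := horner_char_poly (Lmx R n) x^-1.
rewrite (eigenvalues_prod (tr_Lmx R n)) -/E horner_prod => e.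
have -> : 1%:M - x *: Lmx R n = x *: (x^-1%:M - Lmx R n).
  by rewrite scalerBr scale_scalar_mx divff.
rewrite detZ -e -[in LHS]sE.
elim: (E) => [|a s IH]; first by rewrite !big_nil mulr1.
rewrite !big_cons /= exprS -IH hornerXsubC.
by field.
Qed.

Lemma W_eig n x : (W R n).[x] = \prod_(i <- eigenvalues (Lmx R n)) (1 - i * x).
Proof.
rewrite W_prod horner_prod; apply: eq_bigr => i _.
by rewrite -polyC1 !(hornerD, hornerN, hornerC, hornerZ, hornerX).
Qed.

Lemma eig_root n mu : mu \in eigenvalues (Lmx R n) -> mu != 0 ->
  (W R n).[mu^-1] = 0.
Proof.
move=> hm m0; rewrite W_eig; apply/eqP; rewrite prodf_seq_eq0.
by apply/hasP; exists mu; rewrite //= divff // subrr.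
Qed.

Lemma root_eig n x : (W R n).[x] = 0 -> x^-1 \in eigenvalues (Lmx R n).
Proof.
move=> h; have x0 : x != 0.
  apply/eqP => x0; have : 0 < (W R n).[x] by apply: W_gt0; rewrite x0; lra.
  by rewrite h ltxx.
move: h; rewrite W_eig => /eqP; rewrite prodf_seq_eq0 => /hasP[i hi /= /eqP e].
have -> // : x^-1 = i.
by apply: (mulIf x0); rewrite mulVf //; move/eqP: e; rewrite subr_eq0 => /eqP.
Qed.

Lemma eig_bounds n mu : mu \in eigenvalues (Lmx R n) -> 0 <= mu < 4.
Proof.
move=> hm; have [->|m0] := eqVneq mu 0; first by apply/andP; split; lra.
have h := eig_root hm m0.
have : 1 / 4 < mu^-1.
  rewrite ltNge; apply/negP => hle; have := W_gt0 n hle.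
  by rewrite h ltxx.
move=> h4; have i0 : 0 < mu^-1 by lra.
have m1 : 0 < mu by rewrite -invr_gt0.
rewrite (ltW m1) /=; rewrite -[mu]invrK -[ltLHS]mul1r ltr_pdivrMr //; lra.
Qed.

(** If the combination W_n - c W_{n-1} does not vanish on an interval, then the
  quotient of W_n by it is strictly monotone there, whence W_n has at most one
  zero in the interval, multiplicity included. *)
Lemma at_most_one_zero m (c a b mu1 mu2 : R) (Q : {poly R}) :
  0 < c -> (forall x, a <= x <= b -> (W R m.+1 - c *: W R m).[x] != 0) ->
  W R m.+1 = (1 - mu1 *: 'X) * (1 - mu2 *: 'X) * Q ->
  mu1 != 0 -> mu2 != 0 -> a <= mu1^-1 <= b -> a <= mu2^-1 <= b -> False.
Proof.
move=> c0 hV eP m1 m2 r1 r2.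
have e := CD_deriv (R := R) m.
move: (W R m.+1) e hV eP => P e hV eP; set V := P - c *: W R m in hV.
have wr x : 0 < P^`().[x] * V.[x] - P.[x] * V^`().[x].
  have {}e := e x.
  rewrite /V derivB derivZ !(hornerD, hornerN, hornerZ).
  have -> : P^`().[x] * (P.[x] - c * (W R m).[x]) - P.[x] * (P^`().[x] - c * (W R m)^`().[x])
    = c * (P.[x] * (W R m)^`().[x] - P^`().[x] * (W R m).[x]) by ring.
  have s0 : 0 < \sum_(k < m.+1) (W R k).[x] ^+ 2.
    rewrite big_ord_recl /= W0 -polyC1 hornerC expr1n ltr_pwDl //.
    by apply: sumr_ge0 => k _; exact: sqr_ge0.
  have n1 : 0 < (m%:R + 1 : R) ^+ 2 by rewrite exprn_gt0 //; have := ler0n R m; lra.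
  apply: mulr_gt0 => //; rewrite -(pmulr_rgt0 _ n1); lra.
clearbody V; clear e.
have lin mu : (1 - mu *: 'X : {poly R}).[mu^-1] = (1 - mu / mu).
  by rewrite -polyC1 !(hornerD, hornerN, hornerC, hornerZ, hornerX).
have z1 : P.[mu1^-1] = 0 by rewrite eP !hornerM lin divff // subrr !mul0r.
have z2 : P.[mu2^-1] = 0 by rewrite eP !hornerM lin divff // subrr mulr0 mul0r.
have [e12|n12] := eqVneq mu1 mu2.
  have dz : P^`().[mu1^-1] = 0.
    have := lin mu1; rewrite divff // subrr eP -e12.
    move: (1 - mu1 *: 'X) => A lA; rewrite !derivM !(hornerD, hornerM) lA.
    by rewrite !(mul0r, mulr0, addr0, add0r).
  by have := wr mu1^-1; rewrite z1 dz !mul0r subrr ltxx.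
have {n12 m1 m2 eP lin} : exists x y, [/\ x < y, a <= x <= b, a <= y <= b, P.[x] = 0 & P.[y] = 0].
  have : mu1^-1 != mu2^-1 by apply: contra_neq n12 => /invr_inj.
  by rewrite neq_lt => /orP[] h; [exists mu1^-1, mu2^-1 | exists mu2^-1, mu1^-1].
move=> [x [y [xy /andP[ax xb] /andP[ay yb] px py]]].
pose F z := P.[z] / V.[z].
have dF z : x <= z <= y -> is_derive z 1 F
    ((P^`().[z] * V.[z] - P.[z] * V^`().[z]) / V.[z] ^+ 2).
  move=> /andP[xz zy]; have vz : V.[z] != 0.
    by apply: hV; rewrite (le_trans ax xz) (le_trans zy yb).
  have dV : derivable (horner V) z 1 by exact: derivable_horner.
  have dP : derivable (horner P) z 1 by exact: derivable_horner.
  have dVi : derivable (fun z => V.[z]^-1) z 1 by exact: (derivableV vz dV).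
  apply: DeriveDef; first exact: (derivableM dP dVi).
  rewrite /F (deriveM dP dVi) (deriveV vz dV).
  rewrite -!derive1E -!derivE /GRing.scale /=.
  by field.
have cF : {within `[x, y], continuous F}.
  apply: derivable_within_continuous => z; rewrite in_itv /= => hz.
  exact: (@ex_derive _ _ _ _ _ _ _ (dF z hz)).
have dF' z : z \in `]x, y[ -> derivable F z 1.
  rewrite in_itv /= => /andP[h1 h2].
  have hz : x <= z <= y by rewrite !ltW.
  exact: (@ex_derive _ _ _ _ _ _ _ (dF z hz)).
have eF : F x = F y by rewrite /F px py !mul0r.
have [z hz dz] := Rolle xy dF' cF eF.
move: hz; rewrite in_itv /= => /andP[h1 h2].
have hz : x <= z <= y by rewrite !ltW.
have := @derive_val _ _ _ _ _ _ _ (dF z hz).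
rewrite (@derive_val _ _ _ _ _ _ _ dz) => ez.
have vz : V.[z] != 0.
  by apply: hV; rewrite (le_trans ax) ?(le_trans _ yb) // ltW.
move: (wr z); rewrite -[X in 0 < X](divfK (expf_neq0 2 vz)) -ez mul0r ltxx //.
Qed.

End Spectrum.

(** * Counting the largest eigenvalues *)

Section Counting.
Context (R : realType).
Implicit Types n m k j : nat.
Local Notation kap := (kap R).
Local Notation ell := (ell R).
Local Notation fl := (fl R).
Local Notation qw := (qw R).
Local Notation b := (cb R).

Lemma sorted_count_ge (s : seq R) (y : R) i : sorted <=%R s -> (i < size s)%N ->
  (y <= nth 0 s i) = (size s <= i + count (fun z => (y <= z)%R) s)%N.
Proof.
elim: s i => [//|x s IH] i /= xs hi.
have ss := path_sorted xs.
have hx : forall z, z \in s -> x <= z.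
  by apply/allP; move: xs; rewrite (path_sortedE le_trans) => /andP[].
case: (lerP y x) => yx.
  have e : count (fun z => y <= z) s = size s.
    by apply/eqP; rewrite -all_count; apply/allP => z /hx; exact: le_trans.
  rewrite e add1n addnS ltnS leq_addl.
  case: i hi => [|i] hi //=; rewrite (le_trans yx) // hx // mem_nth //.
case: i hi => [|i] hi /=.
  rewrite add0n add0n leNgt yx; apply/esym/negbTE; rewrite -ltnNge ltnS.
  exact: count_size.
by rewrite IH // addSn ltnS add0n.
Qed.

(** The indices n at which the errors of [W_sin] and [flux_cos], with constants M1
  and M2, are small on the interval from 0 to X. *)
Definition large (X M1 M2 : R) n :=
  14 + X + 12 * M1 * X ^+ 3 + 12 * M1 * X ^+ 2 + 9 * M2 * X <= ell n.

Section Fixed.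
Variables (j : nat) (M1 M2 : R) (m : nat).
Let X : R := pi * j%:R + 1.
Let n := m.+1.
Let l : R := ell n.
Hypotheses (M10 : 0 < M1) (M20 : 0 < M2).
Hypothesis hW : forall n x, 14 <= ell n -> X <= ell n ->
  0 < x <= X ->
  `|x / ell n * (gsol n (lam n x) / kap) - sin x| <= M1 * x ^+ 3 / ell n ^+ 2.
Hypothesis hF : forall m x, 14 <= ell m.+1 -> X <= ell m.+1 ->
  0 < x <= X ->
  `|qw m * (gsol m.+1 (lam m.+1 x) - gsol m (lam m.+1 x)) / kap - fl m * cos x|
    <= M2 * x / ell m.+1.
Hypothesis hn : large X M1 M2 n.

Let X1 : 1 <= X.
Proof. by rewrite /X lerDr mulr_ge0 // pi_ge0. Qed.

Let l_bounds : [/\ 14 <= l, X <= l, 12 * (M1 * X ^+ 3) <= l, 12 * (M1 * X ^+ 2) <= l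
  & 9 * (M2 * X) <= l].
Proof.
move: hn; rewrite /large -/l => h; have x0 : 0 < X by have := X1; lra.
have h1 : 0 < M1 * X ^+ 3 by rewrite mulr_gt0 ?exprn_gt0.
have h2 : 0 < M1 * X ^+ 2 by rewrite mulr_gt0 ?exprn_gt0.
have h3 : 0 < M2 * X by rewrite mulr_gt0.
by split; lra.
Qed.

Let l0 : 0 < l. Proof. by case: l_bounds => *; lra. Qed.

(* The rescaled value of W_n, close to sin x. *)
Let p x := x / l * (gsol n (lam n x) / kap).

Let p_sin x : 0 < x <= X -> [/\ `|p x - sin x| <= M1 * X ^+ 3 / l ^+ 2,
   `|p x - sin x| <= 1 / 12 & `|p x - sin x| <= x / 12].
Proof.
move=> hx; have /andP[x0 xX] := hx; have [l14 lX h1 h2 _] := l_bounds.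
have h := hW l14 lX hx; rewrite -/(p x) -/l in h.
have l2 : 0 < l ^+ 2 by rewrite exprn_gt0.
have ll : l <= l ^+ 2 by rewrite expr2 ler_peMl //; lra.
have x3 : x ^+ 3 <= X ^+ 3 by rewrite lerXn2r // nnegrE; lra.
have x2 : x ^+ 2 <= X ^+ 2 by rewrite lerXn2r // nnegrE; lra.
have a1 : M1 * x ^+ 3 / l ^+ 2 <= M1 * X ^+ 3 / l ^+ 2.
  by rewrite ler_pM2r ?invr_gt0 // ler_pM2l.
split; first exact: le_trans a1.
  apply: (le_trans h); apply: (le_trans a1); rewrite ler_pdivrMr //; lra.
apply: (le_trans h); have -> : M1 * x ^+ 3 / l ^+ 2 = x * (M1 * x ^+ 2 / l ^+ 2) by ring.
rewrite ler_pM2l // ler_pdivrMr //.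
have : M1 * x ^+ 2 <= M1 * X ^+ 2 by rewrite ler_pM2l.
by lra.
Qed.

Let W_p x : 0 < x -> (W R n).[lam n x] = p x * (kap * b n * l / x).
Proof.
move=> x0; rewrite /p /gsol; field.
by rewrite !gt_eqF ?cb_gt0 ?kap_gt0.
Qed.

Let wpos x : 0 < x -> 0 < kap * b n * l / x.
Proof.
move=> x0; apply: divr_gt0 => //; apply: mulr_gt0; last exact: l0.
by apply: mulr_gt0; [exact: kap_gt0 | exact: cb_gt0].
Qed.

Let W_root x : 0 < x -> (W R n).[lam n x] = 0 -> p x = 0.
Proof.
move=> x0; rewrite W_p // => /eqP; rewrite mulf_eq0 => /orP[/eqP //|/eqP h].
by have := wpos x0; rewrite h ltxx.
Qed.

Let pi_le k : (k <= j)%N -> pi * k%:R <= pi * j%:R :> R.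
Proof. by move=> h; rewrite ler_pM2l ?pi_gt0 // ler_nat. Qed.

Let pik k : 0 <= pi * k%:R :> R.
Proof. by rewrite mulr_ge0 // pi_ge0. Qed.

Let sgn_norm k (z : R) : `|(-1) ^+ k * z| = `|z|.
Proof. by rewrite normrM normrX normrN1 expr1n mul1r. Qed.

Let no_root_start x : 0 < x <= 1 -> (W R n).[lam n x] != 0.
Proof.
move=> /andP[x0 x1]; apply/eqP => /(W_root x0) h.
have hx : 0 < x <= X by rewrite x0 (le_trans x1 X1).
have [_ _] := p_sin hx; rewrite h sub0r normrN.
have := @sin_window R x; rewrite (gtr0_norm x0) => /(_ x1) a b0; lra.
Qed.

Let root_loc k x : (k < j)%N -> pi * k%:R + 1 < x <= pi * k.+1%:R + 1 ->
  (W R n).[lam n x] = 0 ->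
  `|x - pi * k.+1%:R| <= 1 /\ `|x - pi * k.+1%:R| <= 2 * (M1 * X ^+ 3) / l ^+ 2.
Proof.
move=> kj /andP[h1 h2] rt; have := pik k => k0.
have x0 : 0 < x by lra.
have xX : x <= X by have := pi_le kj; rewrite /X; lra.
have [e1 e2 _] := p_sin (introT andP (conj x0 xX)).
have pz := W_root x0 rt; rewrite pz sub0r normrN in e1 e2.
have [y ey] : exists y, x = pi * k%:R + y by exists (x - pi * k%:R); ring.
have ek : pi * k.+1%:R = pi * k%:R + pi :> R by rewrite -natr1; ring.
have hy : `|x - pi * k.+1%:R| <= 1.
  rewrite ler_norml; apply/andP; split; last by lra.
  rewrite leNgt; apply/negP => hlt.
  have : 1 / 3 <= sin y by apply: sin_gap; apply/andP; split; lra.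
  have := e2; rewrite ey sin_pi_shift sgn_norm => a1 a2.
  by move: a1; rewrite ler_norml => /andP[_ a1]; lra.
split=> //.
have := sin_window hy.
have ex : x = pi * k.+1%:R + (x - pi * k.+1%:R) by ring.
move: e1; rewrite {1}ex sin_pi_shift sgn_norm => a1 a2.
have -> : 2 * (M1 * X ^+ 3) / l ^+ 2 = 2 * (M1 * X ^+ 3 / l ^+ 2) by ring.
have := normr_ge0 (x - pi * k.+1%:R); lra.
Qed.

Let sin1_ge : 1 / 3 <= sin (1 : R).
Proof. by apply: sin_gap; have := pi_ge2 R => h; apply/andP; split; lra. Qed.

Let sgn_le k (z : R) : (-1) ^+ k * z <= `|z|.
Proof. by rewrite -(sgn_norm k z) ler_norm. Qed.

Let sgn_sq k : (-1) ^+ k * (-1) ^+ k = 1 :> R.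
Proof. by rewrite -exprMn mulrNN mulr1 expr1n. Qed.

Let sign_up k : (k <= j)%N -> 0 < (-1) ^+ k * (W R n).[lam n (pi * k%:R + 1)].
Proof.
move=> kj; have x0 : 0 < pi * k%:R + 1 :> R by have := pik k; lra.
have xX : pi * k%:R + 1 <= X by have := pi_le kj; rewrite /X; lra.
have [_ e2 _] := p_sin (introT andP (conj x0 xX)).
rewrite W_p // mulrA pmulr_lgt0 ?wpos //; move: e2; set q := p _.
rewrite sin_pi_shift distrC => e2; have := le_trans (sgn_le k _) e2.
by rewrite mulrBr mulrA sgn_sq mul1r => h; have := sin1_ge; lra.
Qed.

Let sign_dn k : (0 < k <= j)%N ->
  0 < (-1) ^+ k * - (W R n).[lam n (pi * k%:R - 1)].
Proof.
move=> /andP[k0 kj].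
have pk : pi <= pi * k%:R :> R by rewrite ler_peMr ?pi_ge0 // ler1n.
have x0 : 0 < pi * k%:R - 1 :> R by have := pi_ge2 R; lra.
have xX : pi * k%:R - 1 <= X by have := pi_le kj; rewrite /X; lra.
have [_ e2 _] := p_sin (introT andP (conj x0 xX)).
rewrite W_p // -mulNr mulrA pmulr_lgt0 ?wpos //; move: e2; set q := p _.
rewrite sin_pi_shift sinN => e2; have := le_trans (sgn_le k _) e2.
have -> : (-1) ^+ k * (q - (-1) ^+ k * - sin 1) =
  (-1) ^+ k * q - ((-1) ^+ k * (-1) ^+ k) * - sin 1 by ring.
by rewrite sgn_sq mul1r mulrN => h; have := sin1_ge; lra.
Qed.

Let V_neq0 k x : (0 < k <= j)%N -> pi * k%:R - 1 <= x <= pi * k%:R + 1 ->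
  (W R n - (b n / b m) *: W R m).[lam n x] != 0.
Proof.
move=> /andP[k0 kj] /andP[x1 x2].
have pk : pi <= pi * k%:R :> R by rewrite ler_peMr ?pi_ge0 // ler1n.
have x0 : 0 < x by have := pi_ge2 R; lra.
have xX : x <= X by have := pi_le kj; rewrite /X; lra.
have [l14 lX _ _ h5] := l_bounds.
have h := hF l14 lX (introT andP (conj x0 xX)).
have gen (P Q : {poly R}) c z : (P - c *: Q).[z] = P.[z] - c * Q.[z].
  by rewrite !(hornerD, hornerN, hornerZ).
apply/eqP; rewrite gen => e.
have bn := cb_gt0 R n; have bm := cb_gt0 R m.
have eg : gsol n (lam n x) - gsol m (lam n x) = 0.
  transitivity (((W R n).[lam n x] - b n / b m * (W R m).[lam n x]) / b n).
    by rewrite /gsol; field; rewrite !gt_eqF.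
  by rewrite e mul0r.
rewrite -/n eg mulr0 mul0r sub0r normrN in h.
have a1 : M2 * x / l <= 1 / 9.
  rewrite ler_pdivrMr //; have : M2 * x <= M2 * X by rewrite ler_pM2l.
  by lra.
have a2 : 1 / 2 <= `|cos x|.
  have -> : x = pi * k%:R + (x - pi * k%:R) by ring.
  rewrite cos_pi_shift sgn_norm; apply: le_trans (ler_norm _).
  by apply: cos_window; rewrite ler_norml; apply/andP; split; lra.
have a3 : 1 / 4 * (1 / 2) <= fl m * `|cos x|.
  apply: ler_pM => //; apply: le_trans (fl_ge R m); exact: kap_ge14.
have f0 : 0 < fl m by apply: lt_le_trans (fl_ge R m); exact: kap_gt0.
by move: h; rewrite normrM gtr0_norm // => h; lra.
Qed.

Let lam_gt0 (x : R) : 0 < lam n x.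
Proof. by rewrite /lam ltr_pwDl // sqr_ge0. Qed.

Let lam_le (x y : R) : 0 <= x -> x <= y -> lam n x <= lam n y.
Proof.
move=> x0 xy; rewrite /lam lerD2l; apply: lerXn2r; rewrite ?nnegrE.
- by rewrite divr_ge0 // ltW.
- by rewrite divr_ge0 ?(le_trans x0 xy) // ltW.
- by rewrite ler_pM2r ?invr_gt0.
Qed.

Let lam_lt (x y : R) : 0 <= x -> x < y -> lam n x < lam n y.
Proof.
move=> x0 xy; rewrite /lam ltrD2l ltrXn2r //.
- by rewrite divr_ge0 // ltW.
- by rewrite ltr_pM2r ?invr_gt0.
Qed.

Let lam_le_inv (x y : R) : 0 <= x -> 0 <= y -> lam n x <= lam n y -> x <= y.
Proof. by move=> x0 y0; rewrite !leNgt; apply: contra => /lam_lt; exact. Qed.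

Let lam_surj (z : R) : 1 / 4 < z -> exists2 x, 0 < x & z = lam n x.
Proof.
move=> hz; exists (l * Num.sqrt (z - 1 / 4)).
  by rewrite mulr_gt0 // sqrtr_gt0 subr_gt0.
rewrite /lam -/l.
have -> : l * Num.sqrt (z - 1 / 4) / l = Num.sqrt (z - 1 / 4).
  by field; rewrite gt_eqF.
by rewrite sqr_sqrtr; [ring | lra].
Qed.

Let E := eigenvalues (Lmx R n).

(* The inverse of the upper end of the k-th window: for k <= j, exactly k
   eigenvalues are at least thr k. *)
Let thr k : R := (lam n (pi * k%:R + 1))^-1.

Let thr_gt0 k : 0 < thr k. Proof. by rewrite invr_gt0 lam_gt0. Qed.

Let eig_lam (mu : R) : mu \in E -> 0 < mu -> exists x, [/\ 0 < x, mu = (lam n x)^-1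
  & (W R n).[lam n x] = 0].
Proof.
move=> hm m0; have rt := eig_root hm (lt0r_neq0 m0).
have h4 : 1 / 4 < mu^-1.
  by rewrite ltNge; apply/negP => /(W_gt0 n); rewrite rt ltxx.
have [x x0 ex] := lam_surj h4; exists x.
by rewrite -ex invrK.
Qed.

Let thr_le (x : R) k : 0 < x -> (thr k <= (lam n x)^-1) = (x <= pi * k%:R + 1).
Proof.
move=> x0; have y0 : 0 <= pi * k%:R + 1 :> R by have := pik k; lra.
rewrite /thr lef_pV2 ?posrE //; apply/idP/idP; first exact: lam_le_inv (ltW x0) _.
exact: lam_le (ltW x0).
Qed.

Let between k (mu : R) := (thr k.+1 <= mu) && (mu < thr k).

Let between_loc k (mu : R) : (k < j)%N -> mu \in E -> between k mu ->
  exists x, [/\ 0 < x, mu = (lam n x)^-1, (W R n).[lam n x] = 0 &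
    `|x - pi * k.+1%:R| <= 1 /\ `|x - pi * k.+1%:R| <= 2 * (M1 * X ^+ 3) / l ^+ 2].
Proof.
move=> kj hm /andP[h1 h2]; have m0 := lt_le_trans (thr_gt0 k.+1) h1.
have [x [x0 ex rt]] := eig_lam hm m0; exists x; split=> //.
rewrite ex thr_le // in h1; rewrite ltNge ex thr_le // -ltNge in h2.
by apply: root_loc => //; rewrite h2.
Qed.

Let count_between k : (k < j)%N -> count (between k) E = 1%N.
Proof.
move=> kj; have pk := pik k.
have ek : pi * k.+1%:R = pi * k%:R + pi :> R by rewrite -natr1; ring.
have p2 := pi_ge2 R.
have kj' : (0 < k.+1 <= j)%N by [].
apply/eqP; rewrite eqn_leq; apply/andP; split.
  rewrite leqNgt -size_filter; apply/negP => h2.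
  have pe : perm_eq E (seq.filter (between k) E ++ seq.filter (predC (between k)) E).
    by rewrite perm_sym perm_filterC.
  move: h2 pe; case ef : (seq.filter (between k) E) => [|mu1 [|mu2 s]] // _ pe.
  have in1 : mu1 \in seq.filter (between k) E by rewrite ef mem_head.
  have in2 : mu2 \in seq.filter (between k) E by rewrite ef !inE eqxx orbT.
  have loc mu : mu \in seq.filter (between k) E -> mu != 0 /\
      lam n (pi * k.+1%:R - 1) <= mu^-1 <= lam n (pi * k.+1%:R + 1).
    rewrite mem_filter => /andP[hb hm].
    have [x [x0 -> _ [+ _]]] := between_loc kj hm hb.
    rewrite ler_norml => /andP[a1 a2]; rewrite invr_eq0 gt_eqF // invrK.
    by split=> //; apply/andP; split; apply: lam_le; lra.
  have [m1 l1] := loc _ in1; have [m2 l2] := loc _ in2.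
  have c0 : 0 < b n / b m by rewrite divr_gt0 ?cb_gt0.
  have eW : W R m.+1 = (1 - mu1 *: 'X) * (1 - mu2 *: 'X) *
      \prod_(x <- s ++ seq.filter (predC (between k)) E) (1 - x *: 'X).
    transitivity (\prod_(x <- E) (1 - x *: 'X)); first exact: W_prod.
    by rewrite (perm_big _ pe) /= !big_cons mulrA.
  apply: (at_most_one_zero c0 _ eW m1 m2 l1 l2).
  move=> z /andP[z1 z2].
  have [|x x0 ex] := @lam_surj z.
    apply: lt_le_trans z1; rewrite /lam ltrDl exprn_gt0 // divr_gt0 //; lra.
  rewrite ex; apply: (V_neq0 kj'); rewrite ex in z1 z2.
  by apply/andP; split; apply: lam_le_inv => //; lra.
rewrite -has_count; apply/hasP.
have s1 := sign_up kj; have s2 := sign_dn kj'.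
have s0 := sign_up (ltnW kj).
have ll : lam n (pi * k.+1%:R - 1 : R) <= lam n (pi * k.+1%:R + 1 : R).
  by apply: lam_le; lra.
pose Q : {poly R} := ((-1) ^+ k.+1) *: W R n.
have q1 : Q.[lam n (pi * k.+1%:R - 1)] <= 0.
  by rewrite /Q hornerZ; rewrite mulrN oppr_gt0 in s2; rewrite ltW.
have q2 : 0 <= Q.[lam n (pi * k.+1%:R + 1)] by rewrite /Q hornerZ ltW.
have [z zz] := poly_ivt ll (introT andP (conj q1 q2)).
move: zz; rewrite ?in_itv /= => /andP[z1 z2] /rootP; rewrite /Q hornerZ => /eqP.
rewrite mulf_eq0 signr_eq0 /= => /eqP rt.
have [|x x0 ex] := @lam_surj z.
  by apply: lt_le_trans z1; rewrite /lam ltrDl exprn_gt0 // divr_gt0 //; lra.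
rewrite ex in z1 z2 rt; exists (lam n x)^-1; first exact: root_eig.
have y1 : pi * k.+1%:R - 1 <= x by apply: lam_le_inv => //; lra.
have y2 : x <= pi * k.+1%:R + 1 by apply: lam_le_inv => //; lra.
rewrite /between thr_le // y2 /= ltNge thr_le // -ltNge lt_neqAle; apply/andP; split; last by lra.
by apply/eqP => h; move: s0; rewrite h rt mulr0 ltxx.
Qed.

Let count_thr k : (k <= j)%N -> count (fun mu => thr k <= mu) E = k.
Proof.
elim: k => [|k IH] kj.
  apply/eqP; rewrite -leqn0 leqNgt -has_count; apply/negP => /hasP[mu hm h].
  have [x [x0 ex rt]] := eig_lam hm (lt_le_trans (thr_gt0 0) h).
  move: h; rewrite ex thr_le // mulr0 add0r => x1.
  by have := no_root_start (introT andP (conj x0 x1)); rewrite rt eqxx.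
have lt : thr k.+1 <= thr k.
  rewrite /thr lef_pV2 ?posrE //; apply: lam_le; first by have := pik k; lra.
  by rewrite lerD2r ler_pM2l ?pi_gt0 // ler_nat.
have cs s : count (fun mu => thr k.+1 <= mu) s =
    (count (between k) s + count (fun mu => (thr k <= mu)%R) s)%N.
  elim: s => //= z s ->; rewrite /between; case: (lerP (thr k) z) => h.
    by rewrite (le_trans lt h) /= addnCA.
  by rewrite andbT add0n addnA.
by rewrite cs count_between // IH ?add1n // ltnW.
Qed.

Let size_E : size E = n.
Proof. by apply: size_eigenvalues; exact: tr_Lmx. Qed.

Lemma mu_loc_fixed : (0 < j <= n)%N -> exists x,
  [/\ 0 < x, mu R (n - j + 1) n = (lam n x)^-1,
     `|x - pi * j%:R| <= 1 & `|x - pi * j%:R| <= 2 * (M1 * X ^+ 3) / l ^+ 2].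
Proof.
move=> /andP[j0 jn]; rewrite /mu addn1 /= -/E.
have [k jk] : exists k, j = k.+1 by case: (j) j0 => // k _; exists k.
have kj : (k < j)%N by rewrite jk.
have so : sorted <=%R E by exact: eigenvalues_sorted.
have i1 : (n - j < size E)%N by rewrite size_E ltn_subrL j0.
have e : (n - j + k.+1 = n)%N by rewrite -jk subnK.
have h1 := sorted_count_ge (thr k.+1) so i1.
have h2 := sorted_count_ge (thr k) so i1.
rewrite count_thr // size_E in h1; rewrite count_thr ?(ltnW kj) // size_E in h2.
have t1 : thr k.+1 <= nth 0 E (n - j) by rewrite h1 e.
have t2 : nth 0 E (n - j) < thr k by rewrite ltNge h2 -ltnNge -{2}e addnS.
have [x [x0 ex _]] := between_loc kj (mem_nth 0 i1) (introT andP (conj t1 t2)).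
by rewrite -jk => -[a1 a2]; exists x.
Qed.

End Fixed.

(** The j-th largest eigenvalue is 1/(1/4 + (x/ell n)^2) with x close to pi j. *)
Lemma mu_loc j : (0 < j)%N -> exists C L : R, forall n, (j <= n)%N -> L <= ell n ->
  exists x, [/\ 0 < x, mu R (n - j + 1) n = (lam n x)^-1,
     `|x - pi * j%:R| <= 1 & `|x - pi * j%:R| <= C / ell n ^+ 2].
Proof.
move=> j0; set X : R := pi * j%:R + 1.
have [M1 M10 hW] := W_sin X; have [M2 M20 hF] := flux_cos X.
exists (2 * (M1 * X ^+ 3)).
exists (14 + X + 12 * M1 * X ^+ 3 + 12 * M1 * X ^+ 2 + 9 * M2 * X).
move=> [|m] jn hn; first by move: jn j0; case: (j).
apply: (mu_loc_fixed M10 M20 hW hF hn); exact/andP.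
Qed.

End Counting.

(** * The operator norm *)

Section OperatorNorm.
Context (R : realType).
Local Open Scope sesquilinear_scope.
Local Notation normc := ComplexField.Normc.normc.
Local Notation toC := (real_complex R).

Lemma normcC (z : R[i]) : toC (normc z) = `|z|.
Proof. by rewrite normc_def; case: z. Qed.

Lemma enorm_sqE n (v : 'cV[R[i]]_n) :
  enorm v ^+ 2 = \sum_(i < n) normc (v i 0) ^+ 2.
Proof. by rewrite sqr_sqrtr // sumr_ge0 // => i _; exact: sqr_ge0. Qed.

Lemma enorm_sqC n (v : 'cV[R[i]]_n) : toC (enorm v ^+ 2) = (v^t* *m v) 0 0.
Proof.
rewrite enorm_sqE rmorph_sum mxE; apply: eq_bigr => i _.
by rewrite rmorphXn /= normcC normCK !mxE mulrC.
Qed.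

Lemma enorm_ge0 n (v : 'cV[R[i]]_n) : 0 <= enorm v.
Proof. exact: sqrtr_ge0. Qed.

Lemma enorm_unitary n (P : 'M[R[i]]_n) (v : 'cV[R[i]]_n) : P \is unitarymx ->
  enorm (P *m v) = enorm v.
Proof.
move=> Pu; apply/eqP; rewrite -(@eqrXn2 _ 2) ?enorm_ge0 //; apply/eqP.
apply: (fmorph_inj toC); apply: etrans (enorm_sqC _) _.
apply: etrans (esym (enorm_sqC _)).
have PP : P^t* *m P = 1%:M.
  by rewrite -invmx_unitary // mulVmx // unitarymx_unit.
by rewrite trmx_mul map_mxM -mulmxA (mulmxA _ P) PP mul1mx.
Qed.

(** A hermitian matrix with spectrum in [0, M] and M among its eigenvalues has
  operator norm M. *)
Lemma opnorm_diag n (A P : 'M[R[i]]_n) (r : 'I_n -> R) (M : R) :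
  P \is unitarymx -> A = invmx P *m diag_mx (\row_i toC (r i)) *m P ->
  (forall i, 0 <= r i <= M) -> (exists i, r i = M) -> opnorm A = M.
Proof.
move=> Pu eA rM [i0 ri0]; have M0 : 0 <= M.
  by case/andP: (rM i0) => ? ?; apply: le_trans; eauto.
have Piu : invmx P \is unitarymx by rewrite invmx_unitary // trmxC_unitary.
have PP : P *m invmx P = 1%:M by rewrite mulmxV // unitarymx_unit.
have up v : enorm (A *m v) <= M * enorm v.
  rewrite eA -!mulmxA enorm_unitary // -[enorm v](enorm_unitary v Pu).
  set w := P *m v.
  rewrite -(@ler_pXn2r _ 2) ?nnegrE ?mulr_ge0 ?enorm_ge0 //.
  rewrite exprMn !enorm_sqE mulr_sumr; apply: ler_sum => i _.
  rewrite mul_diag_mx !mxE ComplexField.Normc.normcM exprMn.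
  rewrite ler_wpM2r ?sqr_ge0 //; case/andP: (rM i) => h1 h2.
  have -> : normc (toC (r i)) = r i.
    by rewrite /= expr0n /= addr0 sqrtr_sqr ger0_norm.
  by rewrite lerXn2r // nnegrE.
pose v0 : 'cV[R[i]]_n := invmx P *m delta_mx i0 0.
have d1 : enorm (delta_mx i0 0 : 'cV[R[i]]_n) = 1.
  rewrite /enorm (bigD1 i0) //= big1 => [|i ni].
    have n1 : normc (1 : R[i]) = 1 by exact: ComplexField.Normc.normc1.
    by rewrite mxE !eqxx [_%:R]mulr1n n1 expr1n addr0 sqrtr1.
  have n0 : normc (0 : R[i]) = 0 by exact: ComplexField.Normc.normc0.
  by rewrite mxE (negbTE ni) [_%:R]mulr0n n0 expr0n.
have v1 : enorm v0 = 1 by rewrite enorm_unitary.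
have Av0 : enorm (A *m v0) = M.
  rewrite eA /v0 -!mulmxA (mulmxA P) PP mul1mx enorm_unitary // /enorm.
  rewrite (bigD1 i0) //= big1 => [|i ni].
    rewrite mul_diag_mx !mxE !eqxx mulr1 /= ri0 expr0n /= !addr0 sqrtr_sqr.
    by rewrite ger0_norm // sqrtr_sqr ger0_norm.
  by rewrite mul_diag_mx !mxE (negbTE ni) mulr0 ComplexField.Normc.normc0 expr0n.
have bd : forall y, [set enorm (A *m v) | v in [set v : 'cV[R[i]]_n | enorm v <= 1]] y -> y <= M.
  move=> _ [v /= hv <-]; apply: le_trans (up v) _.
  by rewrite ler_piMr.
apply/eqP; rewrite eq_le; apply/andP; split.
  apply: ge_sup; last exact: bd.
  by exists M, v0 => //=; rewrite v1.
apply: ub_le_sup; first by exists M.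
by exists v0 => //=; rewrite v1.
Qed.

Lemma norm_LmxE n : (0 < n)%N -> norm_Lmx R n = mu R n n.
Proof.
move=> n0; rewrite /norm_Lmx; set A := Lmx R n; set AC := map_mx _ A.
have hA : AC \is hermsymmx.
  apply/is_hermitianmxP; rewrite expr0 scale1r.
  apply/matrixP => i j; rewrite !mxE maxnC.
  by apply/esym/CrealP; rewrite complex_real.
have /hermitian_normalmx/orthomx_spectralP eA := hA.
have dr := hermitian_spectral_diag_real hA.
set P := spectralmx AC in eA; set d := spectral_diag AC in eA dr.
have Pu : P \is unitarymx by exact: spectral_unitarymx.
pose r i := complex.Re (d 0 i).
have dE : d = \row_i toC (r i).
  apply/rowP => i; rewrite mxE /r.
  by have /mxOverP/(_ 0 i)/RRe_real := dr.
have cp : map_poly toC (char_poly A) = \prod_(i < n) ('X - (toC (r i))%:P).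
  rewrite map_char_poly -/AC.
  have -> : char_poly AC = char_poly (diag_mx d).
    by rewrite eA char_poly_conj // unitarymx_unit.
  rewrite char_poly_trig ?diag_mx_is_trig //; apply: eq_bigr => i _.
  by rewrite mxE eqxx mulr1n [in LHS]dE mxE.
have cp2 : char_poly A = \prod_(i < n) ('X - (r i)%:P).
  apply: (map_poly_inj toC); rewrite cp rmorph_prod; apply: eq_bigr => i _.
  by rewrite rmorphB /= map_polyX map_polyC.
have memE x : (x \in eigenvalues A) = [exists i, x == r i].
  have : root (char_poly A) x = root (char_poly A) x by [].
  rewrite {1}(eigenvalues_prod (tr_Lmx R n)) root_prod_XsubC => ->.
  rewrite cp2 rootE horner_prod prodf_seq_eq0.
  apply/hasP/existsP => [[i _ /=]|[i /eqP->]].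
    by rewrite hornerXsubC subr_eq0 => h; exists i.
  by exists i; rewrite ?mem_index_enum //= hornerXsubC subrr.
have sE : size (eigenvalues A) = n by apply: size_eigenvalues; exact: tr_Lmx.
have ln : (n.-1 < size (eigenvalues A))%N by rewrite sE prednK.
apply: (opnorm_diag Pu (r := r)); first by rewrite -dE.
- move=> i; have hi : r i \in eigenvalues A by rewrite memE; apply/existsP; exists i.
  have [h0 _] := andP (eig_bounds hi); rewrite h0 /=.
  have si : (index (r i) (eigenvalues A) < size (eigenvalues A))%N by rewrite index_mem.
  rewrite -[leLHS](nth_index 0 hi) /mu.
  apply: (sorted_leq_nth le_trans lexx) => //; first exact: eigenvalues_sorted.
  by rewrite -ltnS prednK // -{2}sE.
- have : mu R n n \in eigenvalues A by exact: mem_nth.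
  by rewrite memE => /existsP[i /eqP ->]; exists i.
Qed.

End OperatorNorm.

(** * Expansion of the eigenvalues *)

Section Expansion.
Context (R : realType).

(** Expansion of 1/(1/4 + (x/l)^2) for x = a + O(1/l^2) and l = L + c + O(1/L). *)
Lemma expansion (a c K1 C0 : R) : 0 <= a -> 0 <= K1 -> 0 <= C0 -> exists K : R,
  forall L l x mu : R, 1 <= L -> `|l - (L + c)| <= K1 / L -> L / 2 <= l ->
    `|x - a| <= 1 -> `|x - a| <= C0 / l ^+ 2 -> mu = (1 / 4 + (x / l) ^+ 2)^-1 ->
  `|mu - (4 - 16 * a ^+ 2 / L ^+ 2 + 32 * a ^+ 2 * c / L ^+ 3)| <= K / L ^+ 4.
Proof.
move=> a0 K10 C00.
pose U := `|c| + K1.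
pose K2 := 2 * K1 + U ^+ 2 + 4 * `|c| * U + 2 * `|c| * U ^+ 2.
exists (64 * (2 * (a + 1)) ^+ 4 + 16 * (16 * C0 * (2 * a + 1)) + 16 * a ^+ 2 * (4 * K2)).
move=> L l x mu L1 hl lL hx1 hx2 ->.
have L0 : 0 < L by lra.
have l0 : 0 < l by lra.
have U0 : 0 <= U by rewrite addr_ge0.
have Ln k : 0 < L ^+ k by rewrite exprn_gt0.
have xa : `|x| <= a + 1.
  by move: hx1; rewrite !ler_norml => /andP[h1 h2]; apply/andP; split; lra.
set t := x / l.
have t2 : 0 <= t ^+ 2 by exact: sqr_ge0.
have inv_l : l^-1 <= 2 / L.
  by rewrite -[_^-1]mul1r ler_pdivrMr // mulrAC ler_pdivlMr //; lra.
have inv_l0 : 0 < l^-1 by rewrite invr_gt0.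
have tb : `|t| <= 2 * (a + 1) / L.
  rewrite /t normrM [`|_^-1|]gtr0_norm //.
  have -> : 2 * (a + 1) / L = (a + 1) * (2 / L) by ring.
  by apply: ler_pM => //; exact: ltW.
have e1 : `|(1 / 4 + t ^+ 2)^-1 - (4 - 16 * t ^+ 2)| <= 64 * (2 * (a + 1)) ^+ 4 / L ^+ 4.
  have -> : (1 / 4 + t ^+ 2)^-1 - (4 - 16 * t ^+ 2) = 64 * t ^+ 4 / (1 + 4 * t ^+ 2).
    by clearbody t; field; lra.
  have t4 : 0 <= t ^+ 4 <= (2 * (a + 1)) ^+ 4 / L ^+ 4.
    have -> : t ^+ 4 = `|t| ^+ 4 by rewrite -normrX ger0_norm // (exprM t 2 2) sqr_ge0.
    rewrite exprn_ge0 //= -expr_div_n; apply: lerXn2r => //; rewrite nnegrE //.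
    exact: le_trans tb.
  case/andP: t4 => t40 t4; rewrite ger0_norm; last by rewrite divr_ge0; lra.
  rewrite ler_pdivrMr; last by lra.
  have -> : 64 * (2 * (a + 1)) ^+ 4 / L ^+ 4 = 64 * ((2 * (a + 1)) ^+ 4 / L ^+ 4) by ring.
  set y := _ / L ^+ 4 in t4 *.
  have : 0 <= y * t ^+ 2 by rewrite mulr_ge0 //; exact: le_trans t4.
  by lra.
have e2 : `|(x ^+ 2 - a ^+ 2) / l ^+ 2| <= 16 * C0 * (2 * a + 1) / L ^+ 4.
  have il2 : (l ^+ 2)^-1 <= 4 / L ^+ 2.
    have -> : (l ^+ 2)^-1 = l^-1 * l^-1 by rewrite expr2 invfM.
    have -> : 4 / L ^+ 2 = 2 / L * (2 / L) by field; lra.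
    by apply: ler_pM; rewrite ?(ltW inv_l0).
  have il20 : 0 < (l ^+ 2)^-1 by rewrite invr_gt0 exprn_gt0.
  have -> : (x ^+ 2 - a ^+ 2) / l ^+ 2 = (x - a) * (x + a) * (l ^+ 2)^-1 by ring.
  rewrite normrM [`|_^-1|]gtr0_norm // normrM.
  have -> : 16 * C0 * (2 * a + 1) / L ^+ 4 = C0 * (4 / L ^+ 2) * (2 * a + 1) * (4 / L ^+ 2).
    by field; lra.
  apply: ler_pM; [by rewrite mulr_ge0 | exact: ltW | | exact: il2].
  apply: ler_pM => //.
    by apply: (le_trans hx2); rewrite ler_wpM2l.
  by move: xa; rewrite !ler_norml => /andP[h1 h2]; apply/andP; split; lra.
have e3 : `|(l ^+ 2)^-1 - (L ^+ 2)^-1 + 2 * c / L ^+ 3| <= 4 * K2 / L ^+ 4.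
  have [eta el] : exists eta, l = L + c + eta by exists (l - (L + c)); ring.
  have he : `|eta| <= K1 / L by move: hl; rewrite el addrC addKr.
  have he1 : `|eta| <= K1.
    by apply: (le_trans he); rewrite ler_pdivrMr // ler_peMr.
  have hLe : `|L * eta| <= K1.
    by rewrite normrM gtr0_norm // mulrC -ler_pdivlMr.
  pose u := c + eta.
  have hu : `|u| <= U by apply: le_trans (ler_normD _ _) _; rewrite /U lerD2l.
  have hu2 : `|u ^+ 2| <= U ^+ 2 by rewrite normrX lerXn2r // nnegrE.
  pose N := - (2 * L * (L * eta)) - L * u ^+ 2 + 4 * c * L * u + 2 * c * u ^+ 2.
  have -> : (l ^+ 2)^-1 - (L ^+ 2)^-1 + 2 * c / L ^+ 3 = N / (L ^+ 3 * l ^+ 2).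
    rewrite /N /u; have -> : eta = l - L - c by rewrite el; ring.
    by field; lra.
  have hN : `|N| <= K2 * L.
    have n1 : `|- (2 * L * (L * eta))| <= 2 * L * K1.
      by rewrite normrN normrM gtr0_norm ?ler_pM2l //; lra.
    have n2 : `|- (L * u ^+ 2)| <= L * U ^+ 2.
      by rewrite normrN normrM gtr0_norm ?ler_pM2l //; lra.
    have n3 : `|4 * c * L * u| <= 4 * `|c| * L * U.
      rewrite !normrM (gtr0_norm L0) (ger0_norm (ler0n R 4)) ler_wpM2l //.
      by rewrite !mulr_ge0 // ltW.
    have n4 : `|2 * c * u ^+ 2| <= 2 * `|c| * U ^+ 2.
      by rewrite normrM normrM (ger0_norm (ler0n R 2)) ler_wpM2l ?mulr_ge0.
    rewrite /N; apply: le_trans (ler_normD _ _) _; apply: le_trans (lerD (sum3_norm n1 n2 n3) n4) _.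
    have : 2 * `|c| * U ^+ 2 <= 2 * `|c| * U ^+ 2 * L.
      by rewrite ler_peMr // mulr_ge0 ?sqr_ge0 ?mulr_ge0.
    by rewrite /K2; lra.
  have K20 : 0 <= K2.
    have := normr_ge0 N => nn; have : 0 <= K2 * L by exact: le_trans hN.
    by rewrite pmulr_lge0.
  have den : 0 < L ^+ 3 * l ^+ 2 by rewrite mulr_gt0 ?exprn_gt0.
  rewrite normrM [`|_^-1|]gtr0_norm ?invr_gt0 // ler_pdivrMr //.
  apply: (le_trans hN).
  have l2 : (L / 2) ^+ 2 <= l ^+ 2 by rewrite lerXn2r // nnegrE; lra.
  have -> : 4 * K2 / L ^+ 4 * (L ^+ 3 * l ^+ 2) = 4 * K2 / L * l ^+ 2 by field; lra.
  have -> : K2 * L = 4 * K2 / L * (L / 2) ^+ 2 by field; lra.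
  by rewrite ler_wpM2l // divr_ge0 ?mulr_ge0 // ltW.
have -> : (1 / 4 + t ^+ 2)^-1 - (4 - 16 * a ^+ 2 / L ^+ 2 + 32 * a ^+ 2 * c / L ^+ 3) =
  ((1 / 4 + t ^+ 2)^-1 - (4 - 16 * t ^+ 2)) + (- 16) * ((x ^+ 2 - a ^+ 2) / l ^+ 2)
  + (- 16 * a ^+ 2) * ((l ^+ 2)^-1 - (L ^+ 2)^-1 + 2 * c / L ^+ 3).
  have -> : (x ^+ 2 - a ^+ 2) / l ^+ 2 = t ^+ 2 - a ^+ 2 / l ^+ 2.
    by rewrite /t; field; lra.
  ring.
have -> : (64 * (2 * (a + 1)) ^+ 4 + 16 * (16 * C0 * (2 * a + 1)) + 16 * a ^+ 2 * (4 * K2)) / L ^+ 4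
  = 64 * (2 * (a + 1)) ^+ 4 / L ^+ 4 + 16 * (16 * C0 * (2 * a + 1) / L ^+ 4)
    + 16 * a ^+ 2 * (4 * K2 / L ^+ 4) by ring.
apply: sum3_norm => //; apply: prod_norm => //.
  by rewrite normrN ger0_norm.
by rewrite mulNr normrN ger0_norm // mulr_ge0 ?sqr_ge0.
Qed.

End Expansion.

Section Conclusion.
Context (R : realType).

Lemma ln_unbounded (M : R) : exists N, forall n, (N <= n)%N -> M <= ln n%:R.
Proof.
have x0 : 0 < expR M by exact: expR_gt0.
exists (Num.trunc (expR M)).+1 => n hn.
have xn : expR M <= n%:R.
  by apply: le_trans (ltW (truncnS_gt _)) _; rewrite ler_nat.
by rewrite -[leLHS]expRK ler_ln ?posrE //; exact: lt_le_trans xn.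
Qed.

Lemma ell_ln_rate : exists2 K : R, 0 <= K & forall n, 1 <= ln (n.+1%:R : R) ->
  `|ell R n.+1 - (ln n.+1%:R + (euler_gamma R + 6 * ln 2))| <= K / ln n.+1%:R.
Proof.
pose g : R := `|euler_gamma R|; have g0 : 0 <= g by exact: normr_ge0.
exists (58 * (9 + g)); first by lra.
move=> n L1; apply: le_trans (ell_ln R n) _.
have h1 := harm_rt R n.+1; have r1 := rt_ge1 R n.+1; have r4 := rt4 R n.+1.
have n0 : 0 < n.+1%:R :> R by rewrite ltr0n.
have n1 : 1 <= n.+1%:R :> R by rewrite ler1n.
have h2 := harm_ln_gamma R (ltn0Sn n).
have i1 : n.+1%:R^-1 <= 1 :> R by rewrite invf_le1.
have hg : - g <= euler_gamma R by rewrite /g lerNl -normrN ler_norm.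
clearbody g.
have h3 : ln n.+1%:R <= (9 + g) * rt R n.+1.
  have hr : g <= g * rt R n.+1 by rewrite ler_peMr.
  move: h2; rewrite ler_norml => /andP[a1 _].
  have s1 : ln n.+1%:R <= harm R n.+1 + 1 + g.
    clear -a1 i1 hg; move: (n.+1%:R^-1) (ln _) (harm _ _) (euler_gamma _) a1 i1 hg => *.
    by lra.
  have s2 : harm R n.+1 + 1 + g <= (9 + g) * rt R n.+1.
    clear -h1 hr r1; move: (rt _ _) (harm _ _) h1 hr r1 => *; lra.
  exact: le_trans s2.
rewrite ler_pdivrMr // mulrAC ler_pdivlMr; last by lra.
have h4 : (2 * harm R n.+1 + 13) * ln n.+1%:R <= (29 * rt R n.+1) * ((9 + g) * rt R n.+1).
  by apply: ler_pM => //; have := harm_ge0 R n.+1; lra.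
apply: (le_trans h4).
have r24 : rt R n.+1 ^+ 2 <= rt R n.+1 ^+ 4 by rewrite ler_weXn2l.
have : rt R n.+1 ^+ 2 <= 2 * n.+1%:R by lra.
have -> : 29 * rt R n.+1 * ((9 + g) * rt R n.+1) = (29 * (9 + g)) * rt R n.+1 ^+ 2 by ring.
have -> : 58 * (9 + g) * n.+1%:R = (29 * (9 + g)) * (2 * n.+1%:R) by ring.
by move=> h5; rewrite ler_wpM2l //; lra.
Qed.

Lemma mu_expansion j : (0 < j)%N -> exists (K : R) N, forall n, (N <= n)%N ->
  `|mu R (n - j + 1) n -
     (4 - 16 * pi ^+ 2 * j%:R ^+ 2 / ln n%:R ^+ 2
      + 32 * pi ^+ 2 * j%:R ^+ 2 * (euler_gamma R + 6 * ln 2) / ln n%:R ^+ 3)|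
  <= K / ln n%:R ^+ 4.
Proof.
move=> j0; have [C [Lt hmu]] := mu_loc R j0; have [K1 K10 hl] := ell_ln_rate.
set c := euler_gamma R + 6 * ln 2 in hl *.
have a0 : 0 <= pi * j%:R :> R by rewrite mulr_ge0 // pi_ge0.
have [K hK] := expansion c a0 K10 (normr_ge0 C).
have [N hN] := ln_unbounded (1 + `|Lt| + 2 * (`|c| + K1)).
exists K, (maxn N (maxn j 1)) => -[|n]; first by rewrite !geq_max ltn0 !andbF.
rewrite !geq_max => /andP[/hN hL /andP[jn _]].
have nL := normr_ge0 Lt; have nc := normr_ge0 c.
have L1 : 1 <= ln n.+1%:R :> R by lra.
have hln := hl n L1; set L := ln n.+1%:R in hL L1 hln *.
have hln2 : `|ell R n.+1 - (L + c)| <= K1.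
  by apply: (le_trans hln); rewrite ler_pdivrMr ?ler_peMr //; lra.
have c1 : - `|c| <= c by rewrite lerNl -normrN ler_norm.
have c2 : Lt <= `|Lt| by exact: ler_norm.
have [el1 el2] : Lt <= ell R n.+1 /\ L / 2 <= ell R n.+1.
  by move: hln2; rewrite ler_norml => /andP[b1 b2]; split; lra.
have [x [x0 -> h1 h2]] := hmu _ jn el1.
have l0 : 0 < ell R n.+1 by exact: ell_gt0.
have h2' : `|x - pi * j%:R| <= `|C| / ell R n.+1 ^+ 2.
  apply: (le_trans h2); rewrite ler_pM2r ?ler_norm // invr_gt0 exprn_gt0 //.
apply: le_trans (hK L (ell R n.+1) x _ L1 hln el2 h1 h2' erefl).
rewrite le_eqVlt; apply/orP; left; apply/eqP; congr `|_ - _|.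
by rewrite exprMn; ring.
Qed.

End Conclusion.

Theorem theorem3 (R : realType) :
  (forall j : nat, (1 <= j)%N ->
     (fun n : nat => mu R (n - j + 1) n)
     = (fun n : nat =>
          4 - 16 * pi ^+ 2 * j%:R ^+ 2 / ln n%:R ^+ 2
            + 32 * pi ^+ 2 * j%:R ^+ 2 * (euler_gamma R + 6 * ln 2)
              / ln n%:R ^+ 3)
       +O_\oo (fun n : nat => 1 / (ln n%:R : R) ^+ 4))
  /\
  (fun n : nat => norm_Lmx R n)
  = (fun n : nat =>
       4 - 16 * pi ^+ 2 / ln n%:R ^+ 2
         + 32 * pi ^+ 2 * (euler_gamma R + 6 * ln 2) / ln n%:R ^+ 3)
    +O_\oo (fun n : nat => 1 / (ln n%:R : R) ^+ 4).
Proof.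
have main (f g : nat -> R) (K : R) N :
    (forall n, (N <= n)%N -> `|f n - g n| <= K / ln n%:R ^+ 4) ->
    f = g +O_\oo (fun n : nat => 1 / (ln n%:R : R) ^+ 4).
  move=> h; apply/eqaddOP/bigO_exP; exists (`|K| + 1); first by rewrite ltr_wpDl.
  exists N => // n /= /h {}h; apply: (le_trans h).
  have ge0 : 0 <= (ln (n%:R : R) ^+ 4)^-1.
    by rewrite invr_ge0 (exprM _ 2 2) sqr_ge0.
  rewrite div1r (ger0_norm ge0) ler_wpM2r //.
  by apply: le_trans (ler_norm K) _; rewrite lerDl.
split=> [j j1|].
  by have [K [N h]] := mu_expansion R j1; exact: main h.
have [K [N h]] := mu_expansion R (ltn0Sn 0).
apply: (main _ _ K (maxn N 1)) => n; rewrite geq_max => /andP[Nn n1].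
have := h n Nn; rewrite subnK // -norm_LmxE //.
by rewrite expr1n !mulr1.
Qed.
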